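(* Let $n\geq3$ and let $\rho_{A_1A_2A_3}$ be a state on $H_{A_1}\otimes H_{A_2}\otimes H_{A_3}$ with $\dim H_{A_1}=\dim H_{A_2}=2$, $\dim H_{A_3}=2^{n-2}$. Let $k\geq 1$, $0<q\leq 1$, $\beta\leq 0$, $s\geq 2$. (1) If $C^s(\rho_{A_1A_3})\geq k\,C^s(\rho_{A_1A_2})$, then $$C^\beta(\rho_{A_1|A_2A_3})\leq q^{\beta/s}C^\beta(\rho_{A_1A_2})+\frac{(1+k)^{\beta/s}-q^{\beta/s}}{k^{\beta/s}}C^\beta(\rho_{A_1A_3}).$$ (2) If $C^s(\rho_{A_1A_2})\geq k\,C^s(\rho_{A_1A_3})$, then $$C^\beta(\rho_{A_1|A_2A_3})\leq q^{\beta/s}C^\beta(\rho_{A_1A_3})+\frac{(1+k)^{\beta/s}-q^{\beta/s}}{k^{\beta/s}}C^\beta(\rho_{A_1A_2}).$$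
   Context: For a bipartite pure state $|\varphi\rangle_{XY}$, the concurrence is $C(|\varphi\rangle)=\sqrt{2[1-\mathrm{tr}(\rho_X^2)]}$ with $\rho_X=\mathrm{tr}_Y|\varphi\rangle\langle\varphi|$; for mixed $\rho_{XY}$, $C(\rho_{XY})=\min\sum_ip_iC(|\varphi_i\rangle)$ over all pure-state ensembles $\{p_i,|\varphi_i\rangle\}$ of $\rho_{XY}$. $\rho_{A_1A_2},\rho_{A_1A_3}$ are reduced states, and $\rho_{A_1|A_2A_3}$ is $\rho_{A_1A_2A_3}$ viewed as a bipartite state for the cut $A_1$ versus $A_2A_3$. $C^\beta$ is the $\beta$-th power of concurrence.
   Formalization: For β<0 the formal statement additionally assumes C(ρ_{A1A2})>0 and C(ρ_{A1A3})>0, since otherwise C^β is zero to a negative power and the right-hand side is undefined (e.g. for a product state). *)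

(* Defs.v *)
From HB Require Import structures.
From mathcomp Require Import all_boot all_order all_algebra.
From mathcomp Require Import complex.
From mathcomp Require Import boolp classical_sets reals exp.
Set Implicit Arguments. Unset Strict Implicit. Unset Printing Implicit Defensive.
Import Order.TTheory GRing.Theory Num.Theory.
Local Open Scope ring_scope.
Local Open Scope classical_set_scope.

(* Operators (matrices) on the Hilbert space C^T, T a finite index type. *)
Definition op (R : realType) (T : finType) := T -> T -> R[i].
Definition vec (R : realType) (T : finType) := T -> R[i].

Definition qform (R : realType) (T : finType) (rho : op R T) (v : vec R T) : R[i] :=
  \sum_(a : T) \sum_(b : T) conjc (v a) * rho a b * v b.

Definition is_state (R : realType) (T : finType) (rho : op R T) : Prop :=
  (forall a b, rho b a = conjc (rho a b)) /\
  (forall v : vec R T, complex.Im (qform rho v) = 0 /\ 0 <= complex.Re (qform rho v)) /\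
  \sum_(a : T) rho a a = 1.

Definition is_unit_vec (R : realType) (T : finType) (psi : vec R T) : Prop :=
  \sum_(a : T) conjc (psi a) * psi a = 1.

Definition is_ensemble (R : realType) (T : finType) (N : nat)
    (p : 'I_N -> R) (psi : 'I_N -> vec R T) (rho : op R T) : Prop :=
  (forall i, 0 < p i) /\ \sum_(i < N) p i = 1 /\
  (forall i, is_unit_vec (psi i)) /\
  (forall a b, rho a b = \sum_(i < N) ((p i)%:C)%C * psi i a * conjc (psi i b)).

Definition red_pure (R : realType) (X Y : finType) (phi : vec R (X * Y)%type) : op R X :=
  fun x x' => \sum_(y : Y) phi (x, y) * conjc (phi (x', y)).

(* tr(rho_X^2) (real part; it is real) *)
Definition purity (R : realType) (X : finType) (sigma : op R X) : R :=
  complex.Re (\sum_(x : X) \sum_(x' : X) sigma x x' * sigma x' x).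

Definition conc_pure (R : realType) (X Y : finType) (phi : vec R (X * Y)%type) : R :=
  Num.sqrt (2 * (1 - purity (red_pure phi))).

(* C(rho) = min over pure-state ensembles of sum_i p_i C(psi_i)
   (taken as the infimum; it is attained) *)
Definition conc (R : realType) (X Y : finType) (rho : op R (X * Y)%type) : R :=
  inf [set c : R | exists (N : nat) (p : 'I_N -> R) (psi : 'I_N -> vec R (X * Y)%type),
         is_ensemble p psi rho /\ c = \sum_(i < N) p i * conc_pure (psi i)].

Definition red12 (R : realType) (T1 T2 T3 : finType) (rho : op R (T1 * (T2 * T3))%type)
  : op R (T1 * T2)%type :=
  fun u v => \sum_(c : T3) rho (u.1, (u.2, c)) (v.1, (v.2, c)).

Definition red13 (R : realType) (T1 T2 T3 : finType) (rho : op R (T1 * (T2 * T3))%type)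
  : op R (T1 * T3)%type :=
  fun u v => \sum_(b : T2) rho (u.1, (b, u.2)) (v.1, (b, v.2)).

(* Main.v *)
(* Everything rests on the monogamy inequality
     C(A1|A2A3)^2 >= C(A1A2)^2 + C(A1A3)^2,
   after which the bound is an inequality between powers: as [s >= 2] and
   [beta <= 0], it follows from [(a + b)^t <= ((1 + k) a)^t], [t = beta / s <= 0].
   For a pure state, Takagi's factorisation of the symmetric matrix of the polar
   form of [det] writes rho_{A1A2} as a mixture of four 2x2 matrices [X_k], pairwise
   orthogonal for that form, with determinants [l_0 >= l_1 >= l_2 >= l_3 >= 0].
   Mixing them in pairs yields C(A1A2) <= 2 (l_0 - l_1 + l_2 - l_3).  Measuring A2
   in an orthonormal basis splits rho_{A1} into [G_0 + G_1] and yields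
   C(A1A3)^2 <= 8 (det G_0 + det G_1) = 4 (det (G_0 + G_1) + det (G_0 - G_1)), so
   it suffices to find a basis with - det (G_0 - G_1) >= (l_0 - l_1 + l_2 - l_3)^2.
   When [l_0 > 0], the traceless matrices [adj(X_0) X_1] and [adj(X_0) X_2] are
   orthogonal to a traceless [O <> 0] of which [adj(X_0) X_3] is a multiple; in a
   Schur basis of [O], with phases making its triangular form real up to a scalar,
   the eigenbasis of the Pauli matrix sigma_y is such a basis.  The mixed case
   follows by Cauchy-Schwarz. *)

Require Import Defs.
From HB Require Import structures.
From mathcomp Require Import all_boot all_order all_algebra.
From mathcomp Require Import sesquilinear spectral ring lra.
From mathcomp Require Import complex.
From mathcomp Require Import boolp classical_sets reals exp.
Set Implicit Arguments. Unset Strict Implicit. Unset Printing Implicit Defensive.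
Import Order.TTheory GRing.Theory Num.Theory.
Local Open Scope ring_scope.

(** * Inequalities between real powers *)

Section PowerBound.
Variable R : realType.
Implicit Types a b c k q t s : R.

Lemma powR_le_neg a b t : 0 < a -> a <= b -> t <= 0 -> b `^ t <= a `^ t.
Proof.
move=> a0 ab t0.
have [u -> u0] : exists2 u, t = - u & 0 <= u by exists (- t); lra.
rewrite !powRN.
have b0 : 0 < b by apply: lt_le_trans ab.
rewrite lef_pV2 ?posrE ?powR_gt0 //.
by apply: (@ge0_ler_powR _ u u0 a b); rewrite ?nnegrE // ltW.
Qed.

(** As [t <= 0], the coefficient [K - Q] is nonpositive and [(b / k)^t <= a^t], so the right side is
    at least [K a^t]. This is the power [t] of [(1 + k) a], and [(1 + k) a <= a + b]. *)
Lemma powR_split_le a b k q t : 0 < a -> 1 <= k -> 0 < q -> q <= 1 ->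
  t <= 0 -> k * a <= b ->
  (a + b) `^ t <= q `^ t * a `^ t + ((1 + k) `^ t - q `^ t) / k `^ t * b `^ t.
Proof.
move=> a0 k1 q0 q1 t0 kab.
have k0 : 0 < k by apply: lt_le_trans k1.
have b0 : 0 < b by apply: lt_le_trans kab; rewrite mulr_gt0.
set K := (1 + k) `^ t; set Q := q `^ t.
have -> : (K - Q) / k `^ t * b `^ t = (K - Q) * (b / k) `^ t.
  have kV : k^-1 `^ t = (k `^ t)^-1.
    by rewrite -[k^-1]powR_inv1 ?(ltW k0) // powRAC powR_inv1 ?powR_ge0.
  by rewrite powRM ?(ltW b0) ?invr_ge0 ?(ltW k0) // kV; ring.
have Z_le : (b / k) `^ t <= a `^ t.
  by apply: powR_le_neg => //; rewrite ler_pdivlMr // mulrC.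
have KQ : K <= Q by apply: powR_le_neg => //; lra.
apply: (@le_trans _ _ (K * a `^ t)); last by nra.
rewrite /K -powRM ?(ltW a0) //; last by lra.
by apply: powR_le_neg => //; nra.
Qed.

(** Write [x^s = x^2 x^(s-2)] and bound [x^(s-2)] by [c^(s-2)]: here [s >= 2], and both [a] and [b]
    are at most [c]. *)
Lemma powR_add_le_of_sqr a b c s : 0 <= a -> 0 <= b -> 0 <= c -> 2 <= s ->
  a ^+ 2 + b ^+ 2 <= c ^+ 2 -> a `^ s + b `^ s <= c `^ s.
Proof.
move=> a0 b0 c0 s2 abc.
have powS x : 0 <= x -> x `^ s = x ^+ 2 * x `^ (s - 2).
  move=> x0; case: (eqVneq x 0) => [->|xn0].
    by rewrite powR0 ?expr0n ?mul0r //; apply: lt0r_neq0; lra.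
  rewrite -powR_mulrn // -powRD; first by congr powR; lra.
  by apply/implyP.
have le_c x y : 0 <= x -> x ^+ 2 + y ^+ 2 <= c ^+ 2 -> x `^ s <= x ^+ 2 * c `^ (s - 2).
  move=> x0 h; rewrite powS // ler_wpM2l ?sqr_ge0 //.
  apply: (@ge0_ler_powR _ (s - 2) _ x c); rewrite ?nnegrE //; first by lra.
  by rewrite -(@ler_pXn2r _ 2) ?nnegrE // (le_trans _ h) // lerDl sqr_ge0.
rewrite (powS c) //; apply: le_trans (ler_wpM2r (powR_ge0 _ _) abc).
rewrite mulrDl lerD //; first exact: (le_c a b).
by apply: (le_c b a) => //; rewrite addrC.
Qed.

(** [powR_split_le] is applied to [a^s], [b^s] and [t = beta / s]. By convention a negative power of
    0 is 0, not infinity, hence the requirement [0 < a] when [beta < 0]; [b] is then positive by the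
    last hypothesis. *)
Lemma concurrence_power_bound a b c k q beta s : 0 <= a -> 0 <= b -> 0 <= c ->
  1 <= k -> 0 < q -> q <= 1 -> beta <= 0 -> 2 <= s ->
  (beta < 0 -> 0 < a) -> a ^+ 2 + b ^+ 2 <= c ^+ 2 ->
  k * a `^ s <= b `^ s ->
  c `^ beta <= q `^ (beta / s) * a `^ beta
    + ((1 + k) `^ (beta / s) - q `^ (beta / s)) / k `^ (beta / s) * b `^ beta.
Proof.
move=> a0 b0 c0 k1 q0 q1 beta0 s2 pos abc kab.
have s0 : 0 < s by lra.
(* A power with exponent 0 is 1, even that of 0, so both sides are 1 when [beta = 0]. *)
move: beta0; rewrite le_eqVlt => /orP[/eqP->|beta0].
  by rewrite mul0r !powRr0; lra.
have powE x : x `^ beta = (x `^ s) `^ (beta / s).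
  by rewrite -powRrM mulrC divfK // lt0r_neq0.
have t0 : beta / s <= 0 by rewrite pmulr_lle0 ?invr_gt0 // ltW.
have As0 : 0 < a `^ s by rewrite powR_gt0 // pos.
rewrite !powE; apply: le_trans (powR_split_le As0 k1 q0 q1 t0 kab).
apply: powR_le_neg => //; last exact: powR_add_le_of_sqr.
by rewrite ltr_pwDl // powR_ge0.
Qed.

End PowerBound.

(** * Takagi factorisation of complex symmetric matrices *)

Section Takagi.
Import Num.Def.
Variable C : numClosedFieldType.
Local Open Scope sesquilinear_scope.
Local Notation cj := (map_mx conjC).

Lemma conjmxM m n p (A : 'M[C]_(m, n)) (B : 'M[C]_(n, p)) :
  cj (A *m B) = cj A *m cj B.
Proof. exact: map_mxM. Qed.

Lemma conjmxK m n (A : 'M[C]_(m, n)) : cj (cj A) = A.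
Proof. by apply/matrixP => i j; rewrite !mxE conjCK. Qed.

Lemma conjmxZ m n a (A : 'M[C]_(m, n)) : cj (a *: A) = a^* *: cj A.
Proof. by apply/matrixP => i j; rewrite !mxE rmorphM. Qed.

Lemma conjmxD m n (A B : 'M[C]_(m, n)) : cj (A + B) = cj A + cj B.
Proof. by apply/matrixP => i j; rewrite !mxE rmorphD. Qed.

Lemma dotmx_ge0 n (u : 'rV[C]_n) : 0 <= (u *m u ^t*) 0 0.
Proof. by rewrite mxE sumr_ge0 // => i _; rewrite !mxE mul_conjC_ge0. Qed.

Lemma dotmx_gt0 n (u : 'rV[C]_n) : u != 0 -> 0 < (u *m u ^t*) 0 0.
Proof. by move=> u0; rewrite -dotmxE; apply: dotmx_is_dotmx. Qed.

(* An eigenvector [u] of [S S^*], with eigenvalue [lam^2], is mapped by the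
   antilinear operator [u |-> (u S)^*] to a vector [w]; then [w + lam u] is a
   coneigenvector, unless it vanishes, in which case ['i u] is one. *)
Lemma coneigenvector n (S : 'M[C]_n.+1) : S^T = S ->
  exists2 u : 'rV_n.+1, u != 0 &
    exists2 lam : C, 0 <= lam & u *m S = lam *: cj u.
Proof.
move=> symS.
have [mu /eigenvalueP [u umu u0]] := eigenvalue_closed (S *m cj S) (ltn0Sn n).
have usE : cj S = S ^t* by rewrite symS.
(* Symmetry makes [cj S] the adjoint of [S], so [mu] times the squared norm of [u] is the squared
   norm of [u *m S]. *)
have mu0 : 0 <= mu.
  rewrite -(pmulr_lge0 _ (dotmx_gt0 u0)).
  have -> : mu * (u *m u ^t*) 0 0 = ((u *m S) *m (u *m S) ^t*) 0 0.
    by rewrite trmx_mul conjmxM mulmxA -(mulmxA u) -usE umu -scalemxAl [RHS]mxE.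
  exact: dotmx_ge0.
set lam := sqrtC mu; have lam0 : 0 <= lam by rewrite sqrtC_ge0.
have lam2 : lam * lam = mu by rewrite -expr2 sqrtCK.
have lamC : lam^* = lam by rewrite geC0_conj.
set w := cj (u *m S).
have wS : w *m S = mu *: cj u.
  rewrite -[S in LHS]conjmxK -conjmxM -mulmxA umu conjmxZ.
  by rewrite geC0_conj.
case: (eqVneq (w + lam *: u) 0) => [v0|v0]; last first.
  exists (w + lam *: u) => //; exists lam => //.
  rewrite mulmxDl wS conjmxD conjmxZ lamC -scalemxAl conjmxK scalerDr scalerA lam2.
  by rewrite addrC.
exists ('i *: u); first by rewrite scaler_eq0 negb_or neq0Ci.
exists lam => //; move/eqP: v0; rewrite addr_eq0 => /eqP wE.
have uS : u *m S = - (lam *: cj u).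
  by rewrite -[u *m S]conjmxK -/w wE -scaleNr conjmxZ rmorphN /= lamC scaleNr.
by rewrite -scalemxAl uS conjmxZ conjCi scaleNr !scalerN !scalerA mulrC.
Qed.

(** Gram-Schmidt on [u] padded with zero rows. The scalar has to be positive because the
    coneigenvector relation is antilinear: rescaling by a phase would change [lam]. *)
Lemma unitary_first_row n (u : 'rV[C]_n.+1) : u != 0 ->
  exists2 V : 'M[C]_(1 + n), V \is unitarymx &
    exists2 c : C, 0 < c & u = c *: row 0 V.
Proof.
move=> u0; pose A : 'M[C]_(1 + n) := col_mx u 0; pose V := schmidt A.
have VU : V \is unitarymx by apply: schmidt_unitarymx.
exists V => //.
have Au : row 0 A = u.
  apply/rowP => j; rewrite mxE /A.
  have z0 : (0 : 'I_(1 + n)) = lshift n (0 : 'I_1) by apply: val_inj.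
  by rewrite z0; apply: col_mxEu.
have := row_schmidt_sub A 0; rewrite Au (big_pred1 0); last first.
  by move=> k; rewrite leqn0.
rewrite genmxE => /sub_rVP [c uE].
exists c => //; have := form1_row_schmidt A 0; rewrite Au uE linearZl_LR /=.
rewrite dotmxE -dotmxE (row_unitarymxP VU) eqxx mulr1 => c0.
rewrite lt_neqAle c0 andbT eq_sym; apply: contraNneq u0 => c00.
by rewrite uE c00 scale0r.
Qed.

(** Induction on the size, with a coneigenvector [v] as first row of [V0]. The first row of [T] is
    [lam *: cj v *m V0^T], which by unitarity is [lam] followed by zeros; symmetry clears the first
    column too, and the remaining block is symmetric. *)
Lemma takagi n (S : 'M[C]_n) : S^T = S ->
  exists2 V : 'M[C]_n, V \is unitarymx &
    exists2 d : 'rV_n, forall i, 0 <= d 0 i & V *m S *m V^T = diag_mx d.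
Proof.
elim: n S => [|n IHn] S symS.
  exists 1%:M; first by apply/unitarymxP; apply/matrixP => -[].
  by exists 0 => [[]//|]; apply/matrixP => -[].
have [u u0 [lam lam0 uS]] := coneigenvector symS.
have [V0 V0U [c c0 uE]] := unitary_first_row u0.
pose v := row 0 V0.
have vS : v *m S = lam *: cj v.
  have c1 : c^* = c by rewrite geC0_conj // ltW.
  have /(congr1 (fun w => c^-1 *: w)) := uS.
  rewrite uE conjmxZ c1 -scalemxAl !scalerA mulVf ?gt_eqF // scale1r => ->.
  by rewrite mulrCA mulVf ?gt_eqF // mulr1.
have [T Tdef] : exists T : 'M[C]_(1 + n), T = V0 *m S *m V0^T by exists (V0 *m S *m V0^T).
have symT : T^T = T by rewrite Tdef !trmx_mul trmxK symS mulmxA.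
have T0 j : T 0 j = lam * (0 == j)%:R.
  have -> : T 0 j = (v *m S *m V0^T) 0 j by rewrite -!row_mul [RHS]mxE Tdef.
  rewrite vS -scalemxAl mxE; congr (_ * _).
  have /matrixP /(_ 0 j) := unitarymxP V0U.
  move=> /(congr1 conjC); rewrite !mxE rmorph_sum /= rmorph_nat => <-.
  by apply: eq_bigr => i _; rewrite !mxE rmorphM /= conjCK.
have TE : T = block_mx lam%:M 0 0 (drsubmx T).
  rewrite -[LHS]submxK; congr block_mx.
  - by apply/matrixP => i j; rewrite !ord1 !mxE lshift0 T0 eqxx mulr1 mulr1n.
  - by apply/matrixP => i j; rewrite !ord1 !mxE lshift0 T0 mulr0.
  - by apply/matrixP => i j; rewrite !ord1 !mxE lshift0 -symT mxE T0 mulr0.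
have [|W WU [d d0 dE]] := IHn (drsubmx T).
  by rewrite trmx_drsub symT.
pose B : 'M[C]_(1 + n) := block_mx 1%:M 0 0 W.
have BU : B \is unitarymx.
  apply/unitarymxP; rewrite tr_block_mx map_block_mx mulmx_block.
  rewrite !trmx0 !(@map_mx0 _ _ conjC) !tr_scalar_mx !map_scalar_mx /=.
  rewrite conjC1 !(mulmx1, mul1mx, mulmx0, mul0mx, addr0, add0r).
  by rewrite (unitarymxP WU) -scalar_mx_block.
exists (B *m V0); first exact: mul_unitarymx.
exists (row_mx lam%:M d : 'rV_(1 + n)).
  move=> i; rewrite mxE; case: splitP => j _ //.
  by rewrite ord1 mxE eqxx mulr1n.
have <- : B *m T *m B^T = diag_mx (row_mx lam%:M d).
  rewrite TE /B tr_block_mx !mulmx_block !trmx0 !trmx1.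
  rewrite !(mulmx1, mul1mx, mulmx0, mul0mx, addr0, add0r) dE.
  rewrite diag_mx_row; congr block_mx.
  by apply/matrixP => i j; rewrite !ord1 !mxE.
by rewrite Tdef trmx_mul !mulmxA.
Qed.

End Takagi.

(** * The determinant of 2x2 matrices as a quadratic form *)

Section Polar.
Variable C : numClosedFieldType.
Implicit Types A B : 'M[C]_2.

Lemma det_mx22 A : \det A = A 0 0 * A 1 1 - A 0 1 * A 1 0.
Proof.
rewrite (expand_det_row _ 0) !big_ord_recl big_ord0 /cofactor !det_mx11 !mxE /=.
rewrite (_ : lift 0 0 = 1); last exact: val_inj.
rewrite (_ : lift 1 0 = 0); last exact: val_inj.
by rewrite addr0 expr0 expr1 mul1r mulN1r mulrN.
Qed.

(** The symmetric bilinear form with [polar A A = 2 * \det A]; on coefficient matrices of two-qubit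
    vectors it is, up to sign, the bilinear form of sigma_y tensor sigma_y used for the spin
    flip. *)
Definition polar A B :=
  A 0 0 * B 1 1 + A 1 1 * B 0 0 - A 0 1 * B 1 0 - A 1 0 * B 0 1.

Lemma polarC A B : polar A B = polar B A.
Proof. by rewrite /polar; ring. Qed.

Lemma polar_suml n (a : 'I_n -> C) (X : 'I_n -> 'M_2) B :
  polar (\sum_i a i *: X i) B = \sum_i a i * polar (X i) B.
Proof.
rewrite /polar !summxE !mulr_suml -!big_split -!sumrB /=.
by apply: eq_bigr => i _; rewrite !mxE; ring.
Qed.

Lemma polar_sumr n (a : 'I_n -> C) (X : 'I_n -> 'M_2) B :
  polar B (\sum_i a i *: X i) = \sum_i a i * polar B (X i).
Proof.
by rewrite polarC polar_suml; apply: eq_bigr => i _; rewrite polarC.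
Qed.

End Polar.

(** * Rank-one decompositions orthogonal for the polar form *)

Section PolarOrthogonal.
Import Num.Def.
Variable C : numClosedFieldType.
Local Open Scope sesquilinear_scope.

(** Spectral theorem: each [e k] is a conjugated row of the diagonalising unitary, scaled by the
    square root of its eigenvalue, which is the value of the form at that row. *)
Lemma psd_sum_rank1 n (A : 'M[C]_n) : A ^t* = A ->
  (forall v : 'rV_n, 0 <= (v *m A *m v ^t*) 0 0) ->
  exists e : 'I_n -> 'I_n -> C,
    forall i j, A i j = \sum_k e k i * (e k j)^*.
Proof.
move=> hermA posA.
have /orthomx_spectralP : A \is normalmx by apply/normalmxP; rewrite hermA.
set P := spectralmx A; set d := spectral_diag A.
have PU : P \is unitarymx by apply: spectral_unitarymx.
rewrite invmx_unitary // => AE.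
have d0 k : 0 <= d 0 k.
  have := posA (row k P); rewrite -row_mul.
  have PPt : P *m P^t* = 1%:M by apply/unitarymxP.
  have -> : P *m A = diag_mx d *m P by rewrite {1}AE !mulmxA PPt mul1mx.
  have -> : (row k (diag_mx d *m P) *m (row k P)^t*) 0 0
    = (diag_mx d *m P *m P^t*) k k.
    by rewrite !mxE; apply: eq_bigr => i _; rewrite !mxE.
  by rewrite -mulmxA PPt mulmx1 mxE eqxx mulr1n.
exists (fun k i => sqrtC (d 0 k) * (P k i)^*) => i j.
rewrite [in LHS]AE mxE; apply: eq_bigr => k _.
rewrite mul_mx_diag !mxE rmorphM /= conjCK (geC0_conj (_ : 0 <= sqrtC _)) ?sqrtC_ge0 //.
by rewrite -[in LHS](sqrtCK (d 0 k)); ring.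
Qed.

(** The columns of [V] are orthonormal, so all cross terms cancel: this is the unitary freedom in
    the choice of an ensemble. *)
Lemma unitary_mix_rank1 n (V : 'M[C]_n) (e : 'I_n -> 'M[C]_2) x y z t :
  V \is unitarymx ->
  \sum_k (\sum_i V k i *: e i) x y * ((\sum_i V k i *: e i) z t)^*
    = \sum_i e i x y * (e i z t)^*.
Proof.
move=> VU.
have VtV i j : \sum_k V k i * (V k j)^* = (i == j)%:R.
  have /matrixP /(_ j i) : V ^t* *m V = 1%:M.
    by apply: mulmx1C; apply/unitarymxP.
  rewrite !mxE eq_sym => <-; apply: eq_bigr => k _.
  by rewrite !mxE mulrC.
transitivity (\sum_k \sum_i \sum_j
    (V k i * (V k j)^*) * (e i x y * (e j z t)^*)).
  apply: eq_bigr => k _; rewrite !summxE rmorph_sum mulr_suml.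
  apply: eq_bigr => i _; rewrite mulr_sumr; apply: eq_bigr => j _.
  by rewrite !mxE rmorphM /=; ring.
rewrite exchange_big /=; apply: eq_bigr => i _.
rewrite exchange_big /= (bigD1 i) //= -mulr_suml VtV eqxx mul1r big1 ?addr0 //.
by move=> j ji; rewrite -mulr_suml VtV eq_sym (negPf ji) mul0r.
Qed.

(** [polar] is bilinear, not sesquilinear, so mixing by [V] turns its matrix [S] on the family into
    [V *m S *m V^T]. Takagi's factorisation makes this diagonal and nonnegative, and the
    determinants are half the diagonal entries. *)
Lemma polar_orthogonal_family n (e : 'I_n -> 'M[C]_2) :
  exists f : 'I_n -> 'M[C]_2,
  [/\ forall x y z t, \sum_k f k x y * (f k z t)^* = \sum_k e k x y * (e k z t)^*,
      forall k l, k != l -> polar (f k) (f l) = 0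
    & forall k, 0 <= \det (f k)].
Proof.
pose S := \matrix_(i, j) polar (e i) (e j).
have symS : S^T = S by apply/matrixP => i j; rewrite !mxE polarC.
have [V VU [d d0 dE]] := takagi symS.
exists (fun k => \sum_i V k i *: e i).
have pE k l : polar (\sum_i V k i *: e i) (\sum_i V l i *: e i) = diag_mx d k l.
  rewrite -dE polar_suml -mulmxA mxE; apply: eq_bigr => i _.
  rewrite polar_sumr mxE; congr (_ * _); apply: eq_bigr => j _.
  by rewrite !mxE mulrC.
split=> [x y z t|k l kl|k]; first exact: unitary_mix_rank1.
  by rewrite pE mxE (negPf kl).
have := pE k k; rewrite mxE eqxx mulr1n; set f := \sum_i _ => fE.
have -> : \det f = d 0 k / 2.
  by rewrite -fE det_mx22 /polar; field.
by rewrite divr_ge0.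
Qed.

Lemma polar_orthogonal_family_sorted (e : 'I_4 -> 'M[C]_2) :
  exists f : 'I_4 -> 'M[C]_2,
  [/\ forall x y z t, \sum_k f k x y * (f k z t)^* = \sum_k e k x y * (e k z t)^*,
      forall k l, k != l -> polar (f k) (f l) = 0,
      forall k, 0 <= \det (f k)
    & forall k l : 'I_4, (k <= l)%N -> \det (f l) <= \det (f k)].
Proof.
have [f [fS f0 fd]] := polar_orthogonal_family e.
pose r : rel 'I_4 := fun i j => \det (f j) <= \det (f i).
pose s := sort r (enum 'I_4).
have sizes : size s = 4 by rewrite size_sort size_enum_ord.
have us : uniq s by rewrite sort_uniq enum_uniq.
(* The order on [C] is only partial, but any two nonnegative elements are comparable. *)
have ss : sorted r s.
  by apply: sort_sorted => i j; apply: ger_leVge.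
exists (fun k : 'I_4 => f (nth ord0 s k)); split.
- move=> x y z t; rewrite -fS -[RHS]big_enum /=.
  have -> : \sum_(i <- enum 'I_4) f i x y * (f i z t)^*
      = \sum_(i <- s) f i x y * (f i z t)^*.
    by apply: perm_big; rewrite perm_sym; apply/permPl/perm_sort.
  by rewrite [RHS](big_nth ord0) big_mkord sizes.
- move=> k l kl; apply: f0; rewrite nth_uniq ?sizes //.
- by move=> k; apply: fd.
- move=> k l kl; apply: (sorted_leq_nth _ _ _ ss); rewrite ?inE ?sizes //.
  + by move=> i j h hi; rewrite /r => /le_trans; apply.
  + by move=> i; rewrite /r.
Qed.

End PolarOrthogonal.

(** * Scalar estimates for a pair of orthogonal traceless matrices *)

Section ScalarCore.
Variable C : numClosedFieldType.

Lemma norm_mul_conj (x y : C) : `|x * y^*| = `|x * y|.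
Proof. by rewrite !normrM norm_conjC. Qed.

(** If [g2 = k a2], the mixed relation forces [g3 = - k a3], and the sum becomes [k^*] times
    [|a2|^2 - |a3|^2], where [|k| |a2|^2 = d2] and [|k| |a3|^2 = d3]. *)
Lemma norm_mixed_le (a2 g2 a3 g3 d2 d3 : C) : 0 <= d3 -> d3 <= d2 ->
  a2 * g2 = - d2 -> a3 * g3 = - d3 -> a2 * g3 + a3 * g2 = 0 ->
  `|a2 * g2^* + a3 * g3^*| <= d2 - d3.
Proof.
move=> d30 d32 ag2 ag3 mix.
have d20 : 0 <= d2 by apply: le_trans d32.
have nd x : 0 <= x -> `|- x| = x :> C by move=> x0; rewrite normrN ger0_norm.
case: (eqVneq a2 0) => [a20|a20].
  have d2E : d2 = 0 by apply/eqP; rewrite -oppr_eq0 -ag2 a20 mul0r.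
  have d3E : d3 = 0 by apply/eqP; rewrite eq_le d30 andbT -d2E.
  by rewrite a20 mul0r add0r norm_mul_conj ag3 nd // d2E d3E subrr.
have [k g2E] : exists k, g2 = k * a2 by exists (g2 / a2); rewrite divfK.
have g3E : g3 = - k * a3.
  by apply: (mulfI a20); apply/eqP; rewrite -subr_eq0 -[0]mix g2E; apply/eqP; ring.
have -> : a2 * g2^* + a3 * g3^* = k^* * (`|a2| ^+ 2 - `|a3| ^+ 2).
  by rewrite g2E g3E !normCK !rmorphM rmorphN /=; ring.
have n2 : `|k| * `|a2| ^+ 2 = d2.
  by rewrite -(nd _ d20) -ag2 g2E !normrM; ring.
have n3 : `|k| * `|a3| ^+ 2 = d3.
  by rewrite -(nd _ d30) -ag3 g3E !normrM normrN; ring.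
by rewrite normrM norm_conjC -{1}(normr_id k) -normrM mulrBr n2 n3 ger0_norm // subr_ge0.
Qed.

(** The matrices have rows [(p, a)] and [(b, -p)], with determinants [d2] and [d3]. If [p = r a]
    with [r] real, putting [g = b + r^2 a] reduces everything to [norm_mixed_le]. If both [a]
    vanish, one [p] vanishes, so [d3 = 0] and only [|p2|^2 = d2] remains. *)
Lemma norm_mixed_traceless_le (p2 a2 b2 p3 a3 b3 d2 d3 : C) :
  0 <= d3 -> d3 <= d2 ->
  - (p2 * p2) - a2 * b2 = d2 -> - (p3 * p3) - a3 * b3 = d3 ->
  p2 * p3 *+ 2 + a2 * b3 + a3 * b2 = 0 ->
  (a2 = 0 /\ a3 = 0) \/
    (exists r, [/\ r^* = r, p2 = r * a2 & p3 = r * a3]) ->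
  `|(a2 * b2^* + p2 * p2^*) + (a3 * b3^* + p3 * p3^*)| <= d2 - d3.
Proof.
move=> d30 d32 e2 e3 mix.
have d20 : 0 <= d2 by apply: le_trans d32.
have nd x : 0 <= x -> `|- x| = x :> C by move=> x0; rewrite normrN ger0_norm.
case=> [[a20 a30]|[r [rC p2E p3E]]]; last first.
  have -> : a2 * b2^* + p2 * p2^* + (a3 * b3^* + p3 * p3^*)
      = a2 * (b2 + r * r * a2)^* + a3 * (b3 + r * r * a3)^*.
    by rewrite p2E p3E !rmorphD !rmorphM /= rC; ring.
  apply: norm_mixed_le => //.
  - by rewrite -e2 p2E; ring.
  - by rewrite -e3 p3E; ring.
  - by rewrite -[RHS]mix p2E p3E; ring.
move: mix; rewrite a20 a30 !mul0r !addr0 !add0r => /eqP.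
rewrite mulrn_eq0 /= mulf_eq0 => p23.
have d3E : d3 = 0.
  case/orP: p23 => /eqP p0; last by rewrite -e3 p0 a30 !mul0r oppr0 addr0.
  apply/eqP; rewrite eq_le d30 andbT (le_trans d32) //.
  by rewrite -e2 p0 a20 !mul0r oppr0 addr0.
have p3E : p3 = 0.
  apply/eqP; move: e3; rewrite d3E a30 mul0r subr0 => /eqP.
  by rewrite oppr_eq0 mulf_eq0 orbb.
rewrite d3E p3E mul0r addr0 subr0 norm_mul_conj -[leRHS](nd _ d20) -e2 a20 mul0r subr0.
by rewrite opprK.
Qed.

End ScalarCore.

(** * Traceless 2x2 matrices under unitary conjugation *)

Section TracelessFrame.
Import Num.Def.
Variable C : numClosedFieldType.
Local Open Scope sesquilinear_scope.
Implicit Types A B O U W : 'M[C]_2.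

Lemma polar_det A B : polar A B = \det (A + B) - \det A - \det B.
Proof. by rewrite !det_mx22 /polar !mxE; ring. Qed.

Lemma polar1mx A : polar 1%:M A = A 0 0 + A 1 1.
Proof. by rewrite /polar !mxE /=; ring. Qed.

Lemma mulmx2E A B i j : (A *m B) i j = A i 0 * B 0 j + A i 1 * B 1 j.
Proof.
rewrite mxE !big_ord_recl big_ord0 addr0.
by rewrite (_ : lift ord0 ord0 = 1) //; apply: val_inj.
Qed.

Lemma mx2P A B : A 0 0 = B 0 0 -> A 0 1 = B 0 1 -> A 1 0 = B 1 0 ->
  A 1 1 = B 1 1 -> A = B.
Proof.
move=> e00 e01 e10 e11; apply/matrixP => i j.
have two (k : 'I_2) : k = 0 \/ k = 1.
  by case: k => -[|[|//]] h; [left|right]; apply: val_inj.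
by case: (two i) => ->; case: (two j) => ->.
Qed.

Lemma unitary_mulV U : U \is unitarymx -> U^t* *m U = 1%:M.
Proof. by move=> /unitarymxP /mulmx1C. Qed.

Lemma det_unitary_conj U A : U \is unitarymx -> \det (U *m A *m U^t*) = \det A.
Proof.
move=> UU; rewrite !det_mulmx mulrAC -det_mulmx (unitarymxP UU).
by rewrite det1 mul1r.
Qed.

Lemma polar_unitary_conj U A B : U \is unitarymx ->
  polar (U *m A *m U^t*) (U *m B *m U^t*) = polar A B.
Proof.
move=> UU; rewrite !polar_det !det_unitary_conj //.
by rewrite -mulmxDl -mulmxDr det_unitary_conj.
Qed.

Lemma trace_unitary_conj U A : U \is unitarymx ->
  (U *m A *m U^t*) 0 0 + (U *m A *m U^t*) 1 1 = A 0 0 + A 1 1.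
Proof.
move=> UU; rewrite -!polar1mx -[RHS](polar_unitary_conj _ _ UU).
by rewrite mulmx1 (unitarymxP UU).
Qed.

Definition diag2 (x y : C) : 'M[C]_2 :=
  \matrix_(i, j) (if i == j then (if i == 0 then x else y) else 0).

Lemma diag2_unitary x y : x * x^* = 1 -> y * y^* = 1 -> diag2 x y \is unitarymx.
Proof.
move=> x1 y1; apply/unitarymxP.
by apply: mx2P; rewrite !mulmx2E !mxE /= ?conjC0 ?mulr0 ?mul0r ?addr0 ?add0r.
Qed.

Lemma unit_phase (z : C) : exists2 w : C, w * w^* = 1 & (w * z)^* = w * z.
Proof.
case: (eqVneq z 0) => [->|z0].
  by exists 1; rewrite ?conjC1 ?mulr1 // mul1r conjC0.
have nz0 : `|z| != 0 by rewrite normr_eq0.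
have nzC : `|z|^* = `|z| by rewrite geC0_conj.
exists (z^* / `|z|).
  rewrite rmorphM fmorphV /= nzC conjCK.
  by rewrite mulrACA [_^* * z]mulrC -normCK -invfM -expr2 divff // expf_neq0.
have -> : z^* / `|z| * z = `|z|.
  by rewrite mulrAC [_^* * z]mulrC -normCK expr2 mulfK.
by [].
Qed.

(** After a Schur triangularisation, conjugating by [diag2 1 w] keeps the diagonal and multiplies
    the lower left entry by [w]; this phase is chosen to make its ratio to the upper left entry
    real. *)
Lemma traceless_schur O : O 0 0 + O 1 1 = 0 ->
  exists2 U, U \is unitarymx & exists A : 'M[C]_2,
    [/\ A = U *m O *m U^t*, A 0 1 = 0 & A 0 0 = 0 \/
     (A 0 0 != 0 /\ exists2 t : C, t^* = t & A 1 0 = t * A 0 0)].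
Proof.
move=> trO.
have [P PU] := Schur O (ltn0Sn 1).
rewrite /similar_to conjymx // => /is_trig_mxP trig.
have [B BE] : exists B, B = P *m O *m P^t* by eexists.
have B01 : B 0 1 = 0 by rewrite BE; apply: trig.
have [w w1 wE] := unit_phase (B 1 0 / B 0 0).
have DU : diag2 1 w \is unitarymx by apply: diag2_unitary; rewrite ?conjC1 ?mulr1.
exists (diag2 1 w *m P); first exact: mul_unitarymx.
exists (diag2 1 w *m B *m (diag2 1 w)^t*); split.
- by rewrite BE trmx_mul map_mxM !mulmxA.
- by rewrite !mulmx2E !mxE /= B01 !(mulr0, mul0r, addr0, conjC0).
- have A00 : (diag2 1 w *m B *m (diag2 1 w)^t*) 0 0 = B 0 0.
    by rewrite !mulmx2E !mxE /= conjC1 !(mulr0, mul0r, addr0, conjC0) mulr1 mul1r.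
  rewrite A00; case: (eqVneq (B 0 0) 0) => [|B00]; [by left|right].
  split=> //; exists (w * (B 1 0 / B 0 0)) => //.
  rewrite !mulmx2E !mxE /= conjC1 !(mulr0, mul0r, addr0, add0r, conjC0) mulr1.
  by rewrite -mulrA divfK.
Qed.

(** If [W4] is nonzero it serves as [O]. Otherwise orthogonality to [W2] and [W3] imposes two linear
    conditions on the three-dimensional space of traceless matrices. *)
Lemma traceless_ortho_vector W2 W3 W4 :
  polar W2 W4 = 0 -> polar W3 W4 = 0 -> W4 0 0 + W4 1 1 = 0 ->
  exists O : 'M[C]_2, [/\ O != 0, O 0 0 + O 1 1 = 0, polar W2 O = 0,
    polar W3 O = 0 & exists c, W4 = c *: O].
Proof.
move=> p24 p34 tr4; case: (eqVneq W4 0) => [W40|W40]; last first.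
  by exists W4; split=> //; exists 1; rewrite scale1r.
(* Coefficients of [polar W O] in the entries [O 0 0], [O 0 1], [O 1 0], once [O 1 1 = - O 0 0] is
   substituted. *)
pose col W : 'cV[C]_3 := \col_(i < 3)
  (if i == 0 :> nat then W 1 1 - W 0 0 else if i == 1 :> nat then - W 1 0 else - W 0 1).
pose M : 'M[C]_(3, 1 + 1) := row_mx (col W2) (col W3).
have : kermx M != 0.
  rewrite -mxrank_eq0 mxrank_ker subn_eq0 -ltnNge.
  exact: leq_ltn_trans (rank_leq_col M) _.
case/rowV0Pn => v /sub_kermxP; rewrite mul_mx_row => vM v0.
have [vM2 vM3] : v *m col W2 = 0 /\ v *m col W3 = 0.
  by apply: eq_row_mx; rewrite vM row_mx0.
pose x := v 0 0; pose y := v 0 1; pose z := v 0 (inord 2).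
have ord3 (i : 'I_3) : [\/ i = 0, i = 1 | i = inord 2].
  case: i => -[|[|[|//]]] h; [constructor 1|constructor 2|constructor 3];
  by apply: val_inj; rewrite //= inordK.
pose O : 'M[C]_2 := \matrix_(i, j)
  (if i == 0 then (if j == 0 then x else y) else (if j == 0 then z else - x)).
have OE : [/\ O 0 0 = x, O 0 1 = y, O 1 0 = z & O 1 1 = - x] by rewrite !mxE.
case: OE => O00 O01 O10 O11.
have pO W : v *m col W = 0 -> polar W O = 0.
  move=> /matrixP /(_ 0 0); rewrite !mxE !big_ord_recl big_ord0 !mxE /= => e.
  rewrite -[RHS]e /polar O00 O01 O10 O11 /x /y /z.
  rewrite (_ : lift ord0 ord0 = 1); last exact: val_inj.
  rewrite (_ : lift ord0 (lift ord0 ord0) = inord 2); last first.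
    by apply: val_inj; rewrite /= inordK.
  by ring.
exists O; split; rewrite ?O00 ?O11 ?subrr //; try exact: pO.
- apply: contraNneq v0 => O0; apply/eqP/rowP => i; rewrite mxE.
  move: O00 O01 O10; rewrite O0 !mxE /x /y /z => x0 y0 z0.
  by case: (ord3 i) => ->.
- by exists 0; rewrite scale0r W40.
Qed.

End TracelessFrame.

(** * A frame in which minus the determinant is large *)

Section Frame.
Import Num.Def.
Variable C : numClosedFieldType.
Local Open Scope sesquilinear_scope.
Implicit Types A B O U W S : 'M[C]_2.

Definition pauliY : 'M[C]_2 :=
  \matrix_(i, j) (if i == j then 0 else if i == 0 then - 'i else 'i).

Lemma pauliY_herm : pauliY^t* = pauliY.
Proof.
by apply: mx2P; rewrite !mxE /= ?conjC0 ?rmorphN /= ?conjCi ?opprK.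
Qed.

Lemma sandwichY_E W i j : (W *m pauliY *m W^t*) i j
  = 'i * (W i 1 * (W j 0)^*) - 'i * (W i 0 * (W j 1)^*).
Proof. by rewrite !mulmx2E !mxE /=; ring. Qed.

Lemma tradjM A B : (A *m B)^t* = B^t* *m A^t*.
Proof. by rewrite trmx_mul map_mxM. Qed.

Lemma tradjK A : A^t*^t* = A. Proof. exact: trmxCK. Qed.

Lemma sandwich_herm S W : S^t* = S -> (W *m S *m W^t*)^t* = W *m S *m W^t*.
Proof. by move=> hS; rewrite !tradjM tradjK hS mulmxA. Qed.

Lemma herm_corner0_det A : A^t* = A -> A 0 0 = 0 -> - \det A = `|A 0 1| ^+ 2.
Proof.
move=> hA A0; rewrite det_mx22 A0 mul0r sub0r opprK normCK; congr (_ * _).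
by rewrite -[in LHS]hA !mxE.
Qed.

Lemma tradjD A B : (A + B)^t* = A^t* + B^t*.
Proof. by rewrite linearD map_mxD. Qed.

Lemma unitary_conj_sandwich U W (S := U^t* *m pauliY *m U) : U \is unitarymx ->
  U *m (W *m S *m W^t*) *m U^t*
    = (U *m W *m U^t*) *m pauliY *m (U *m W *m U^t*)^t*.
Proof. by move=> UU; rewrite !tradjM tradjK /S !mulmxA. Qed.

(* Conjugating by [U] puts a matrix orthogonal to [W2] and [W3] and proportional
   to [W4] in a triangular form that is real up to a scalar.  This kills the
   upper left entry, and the determinant reduces to the off-diagonal one. *)
Lemma traceless_frame W2 W3 W4 (d2 d3 d4 : C) :
  W2 0 0 + W2 1 1 = 0 -> W3 0 0 + W3 1 1 = 0 -> W4 0 0 + W4 1 1 = 0 ->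
  \det W2 = d2 -> \det W3 = d3 -> \det W4 = d4 ->
  polar W2 W3 = 0 -> polar W2 W4 = 0 -> polar W3 W4 = 0 ->
  0 <= d3 -> d3 <= d2 -> 0 <= d4 ->
  exists2 U, U \is unitarymx & let S := U^t* *m pauliY *m U in
    forall L : C, 0 <= L -> d2 - d3 + d4 <= L ->
    (L - d2 + d3 - d4) ^+ 2 <=
      - \det (L *: S + W2 *m S *m W2^t* + W3 *m S *m W3^t* + W4 *m S *m W4^t*).
Proof.
move=> t2 t3 t4 e2 e3 e4 p23 p24 p34 d30 d32 d40.
have [O [O0 trO pO2 pO3 [c W4E]]] := traceless_ortho_vector p24 p34 t4.
have [U UU [A [AE A01 Acase]]] := traceless_schur trO.
exists U => // S L L0 dL.
rewrite -(det_unitary_conj _ UU) !mulmxDr !mulmxDl !unitary_conj_sandwich //.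
have -> : U *m (L *: S) *m U^t* = L *: pauliY.
  rewrite -scalemxAr -scalemxAl /S !mulmxA (unitarymxP UU) mul1mx -mulmxA.
  by rewrite (unitarymxP UU) mulmx1.
have trE W : W 0 0 + W 1 1 = 0 -> (U *m W *m U^t*) 1 1 = - (U *m W *m U^t*) 0 0.
  by move=> tW; apply/eqP; rewrite -addr_eq0 addrC trace_unitary_conj // tW.
have polarA W : polar W O = 0 -> polar (U *m W *m U^t*) A = 0.
  by move=> pW; rewrite AE polar_unitary_conj.
have trA : A 1 1 = - A 0 0 by rewrite AE trE.
have V4E : U *m W4 *m U^t* = c *: A by rewrite W4E AE -scalemxAr -scalemxAl.
move: (trE _ t2) (trE _ t3) (polarA _ pO2) (polarA _ pO3).
rewrite -(det_unitary_conj _ UU) in e2; rewrite -(det_unitary_conj _ UU) in e3.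
rewrite -(det_unitary_conj _ UU) in e4.
rewrite -(polar_unitary_conj _ _ UU) in p23.
move: V4E e2 e3 e4 p23.
set V2 := U *m W2 *m _; set V3 := U *m W3 *m _; set V4 := U *m W4 *m _.
move: V2 V3 V4 => V2 V3 V4 V4E e2 e3 e4 p23 t2' t3' pA2 pA3.
have hZ : (L *: pauliY + V2 *m pauliY *m V2^t* + V3 *m pauliY *m V3^t*
    + V4 *m pauliY *m V4^t*)^t* = L *: pauliY + V2 *m pauliY *m V2^t*
    + V3 *m pauliY *m V3^t* + V4 *m pauliY *m V4^t*.
  rewrite !tradjD !(sandwich_herm _ pauliY_herm); congr (_ + _ + _ + _).
  rewrite linearZ /= map_mxZ /= pauliY_herm.
  by rewrite -[in RHS](geC0_conj L0).
have V4_01 : V4 0 1 = 0 by rewrite V4E mxE A01 mulr0.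
have lowered (V : 'M[C]_2) : V 1 1 = - V 0 0 -> polar V A = 0 ->
    A 0 0 * V 0 0 *+ 2 + A 1 0 * V 0 1 = 0.
  move=> tV; rewrite /polar tV trA A01 => /eqP; rewrite -oppr_eq0 => /eqP <-.
  by ring.
have low2 := lowered _ t2' pA2; have low3 := lowered _ t3' pA3.
(* Orthogonality to the triangular [A] is one linear relation between [V 0 0] and [V 0 1], and its
   coefficients have a real ratio whenever [A 0 0] is nonzero. *)
have cases : (V2 0 1 = 0 /\ V3 0 1 = 0) \/
    exists r, [/\ r^* = r, V2 0 0 = r * V2 0 1 & V3 0 0 = r * V3 0 1].
  case: Acase => [A00|[A00 [t tC A10]]].
    left; have A10 : A 1 0 != 0.
      apply: contraNneq O0 => A10.
      have A0 : A = 0 by apply: mx2P; rewrite ?A00 ?A01 ?A10 ?trA ?A00 ?oppr0 mxE.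
      have : U^t* *m A *m U = O.
        by rewrite AE !mulmxA unitary_mulV // mul1mx -mulmxA unitary_mulV // mulmx1.
      by rewrite A0 mulmx0 mul0mx => <-.
    by move: low2 low3; rewrite A00 !mul0r !mul0rn !add0r => /eqP + /eqP;
      rewrite !mulf_eq0 (negPf A10) /= => /eqP-> /eqP->.
  right; exists (- t / 2).
  have solve x a : A 0 0 * x *+ 2 + A 1 0 * a = 0 -> x = - t / 2 * a.
    move=> e; apply: (mulfI A00); apply/eqP; rewrite -subr_eq0.
    have -> : A 0 0 * x - A 0 0 * (- t / 2 * a) = (A 0 0 * x *+ 2 + A 1 0 * a) / 2.
      by rewrite A10; field.
    by rewrite e mul0r.
  split; [|exact: solve|exact: solve].
  by rewrite rmorphM rmorphN fmorphV rmorph_nat /= tC.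
set Z := (X in \det X).
(* The corner is ['i] times the difference between [V 0 1 * (V 0 0)^*] and its conjugate, so it
   vanishes when that product is real. *)
have selfconj0 (V : 'M[C]_2) : V 0 1 = 0 \/ (exists2 r, r^* = r & V 0 0 = r * V 0 1) ->
    (V *m pauliY *m V^t*) 0 0 = 0.
  case=> [V0|[r rC V0]]; rewrite sandwichY_E V0 ?mul0r ?conjC0 ?mulr0 ?subrr //.
  by rewrite rmorphM /= rC; ring.
have Z00 : Z 0 0 = 0.
  have [s2 s3] : (V2 *m pauliY *m V2^t*) 0 0 = 0 /\ (V3 *m pauliY *m V3^t*) 0 0 = 0.
    by case: cases => [[z2 z3]|[r [rC r2 r3]]]; split; apply: selfconj0;
      [left|left|right; exists r|right; exists r].
  have s4 : (V4 *m pauliY *m V4^t*) 0 0 = 0 by apply: selfconj0; left.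
  by rewrite /Z mxE s4 mxE s3 mxE s2 !mxE /= mulr0 !addr0.
rewrite herm_corner0_det //.
have e2' : - (V2 0 0 * V2 0 0) - V2 0 1 * V2 1 0 = d2.
  by rewrite -e2 det_mx22 t2'; ring.
have e3' : - (V3 0 0 * V3 0 0) - V3 0 1 * V3 1 0 = d3.
  by rewrite -e3 det_mx22 t3'; ring.
have mix : V2 0 0 * V3 0 0 *+ 2 + V2 0 1 * V3 1 0 + V3 0 1 * V2 1 0 = 0.
  by apply/eqP; rewrite -oppr_eq0 -[X in _ == X]p23 /polar t2' t3'; apply/eqP; ring.
have := norm_mixed_traceless_le d30 d32 e2' e3' mix cases.
set q := (X in `|X|) => q_le.
have t4' : V4 1 1 = - V4 0 0 by rewrite V4E !mxE trA mulrN.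
have q4 : `|V4 0 0 * (V4 0 0)^*| = d4.
  rewrite norm_mul_conj -[RHS](ger0_norm d40) -e4 det_mx22 t4' V4_01 mul0r subr0.
  by rewrite mulrN normrN.
have -> : `|Z 0 1| = `|L - q - V4 0 0 * (V4 0 0)^*|.
  have -> : Z 0 1 = - 'i * (L - q - V4 0 0 * (V4 0 0)^*).
    rewrite /Z mxE sandwichY_E mxE sandwichY_E mxE sandwichY_E t2' t3' t4' V4_01 !mxE /=.
    by rewrite /q !rmorphN /=; ring.
  by rewrite normrM normrN normCi mul1r.
have le0 : 0 <= L - d2 + d3 - d4 by move: dL; rewrite -subr_ge0; congr (_ <= _); ring.
rewrite lerXn2r ?nnegrE //.
(* Two reverse triangle inequalities remove [d4], then [q], whose modulus is at most [d2 - d3]. *)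
apply: le_trans (lerB_dist _ _); rewrite q4 lerB //.
apply: le_trans (lerB_dist _ _); rewrite (ger0_norm L0) -addrA lerD2l.
by rewrite -lerN2 opprD !opprK.
Qed.

Lemma polar_mulmx M A B : polar (M *m A) (M *m B) = \det M * polar A B.
Proof. by rewrite !polar_det -mulmxDr !det_mulmx; ring. Qed.

Lemma polar_scalar (x : C) A : polar x%:M A = x * (A 0 0 + A 1 1).
Proof. by rewrite /polar !mxE /=; ring. Qed.

Lemma det_adj2 A : \det (\adj A) = \det A.
Proof.
rewrite !det_mx22 !mxE /cofactor !det_mx11 !mxE /=.
rewrite (_ : lift 0 0 = 1); last exact: val_inj.
rewrite (_ : lift 1 0 = 0); last exact: val_inj.
by rewrite !expr0 !expr1 -signr_odd /=; ring.
Qed.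

(** Multiplying by [M = \adj (X 0)] makes [X 0] the scalar [l] and scales [polar] by [l], so the
    other [M *m X k] are traceless and stay orthogonal. [traceless_frame] with [L = l ^+ 2] gives
    the bound multiplied by [l ^+ 2]. *)
Lemma frame_det_le (X : 'I_4 -> 'M[C]_2) :
  (forall k l, k != l -> polar (X k) (X l) = 0) ->
  (forall k, 0 <= \det (X k)) ->
  (forall k l : 'I_4, (k <= l)%N -> \det (X l) <= \det (X k)) ->
  exists2 U, U \is unitarymx & let S := U^t* *m pauliY *m U in
    (\det (X 0) - \det (X 1) + \det (X (inord 2)) - \det (X (inord 3))) ^+ 2
      <= - \det (\sum_k X k *m S *m (X k)^t*).
Proof.
move=> X0 Xd Xs.
have sum4 (F : 'I_4 -> 'M[C]_2) :
    \sum_k F k = F 0 + F 1 + F (inord 2) + F (inord 3).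
  rewrite !big_ord_recl big_ord0 addr0 !addrA.
  congr (_ + F _ + F _ + F _); apply: val_inj; rewrite //= inordK //.
have i2 : (inord 2 : 'I_4) = 2 :> nat by rewrite inordK.
have i3 : (inord 3 : 'I_4) = 3 :> nat by rewrite inordK.
set l := \det (X 0).
case: (eqVneq l 0) => [l0|l0].
  have Xd0 k : \det (X k) = 0.
    by apply/eqP; rewrite eq_le Xd andbT -l0 Xs.
  rewrite !Xd0 /l Xd0 !subr0 addr0.
  (* All determinants being 0, only a nonnegative right side is needed: the phase [w] kills the
     upper left entry of the Hermitian sum. *)
  have [w w1 wE] := unit_phase (\sum_k X k 0 0 * (X k 0 1)^*).
  exists (diag2 1 w); first by apply: diag2_unitary; rewrite ?conjC1 ?mulr1.
  rewrite /=; set S := _ *m diag2 1 w.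
  have hS : S^t* = S by rewrite /S !tradjM tradjK pauliY_herm mulmxA.
  have SE : [/\ S 0 0 = 0, S 0 1 = - 'i * w, S 1 0 = 'i * w^* & S 1 1 = 0].
    by rewrite /S !mulmx2E !mxE /= !conjC0 conjC1; split; ring.
  move: S hS SE => S hS [S00 S01 S10 S11].
  rewrite herm_corner0_det.
  - by rewrite expr0n exprn_ge0.
  - by rewrite sum4 !tradjD !sandwich_herm.
  - rewrite summxE.
    transitivity (\sum_k ('i * (w * (X k 0 0 * (X k 0 1)^*))^*
        - 'i * (w * (X k 0 0 * (X k 0 1)^*)))).
      apply: eq_bigr => k _; rewrite !mulmx2E S00 S01 S10 S11 !mxE.
      by rewrite !rmorphM /= conjCK; ring.
    by rewrite sumrB -!mulr_sumr -rmorph_sum -mulr_sumr /= wE subrr.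
have lgt0 : 0 < l by rewrite lt_neqAle eq_sym l0 Xd.
pose M := \adj (X 0).
have MX : M *m X 0 = l%:M by rewrite mul_adj_mx.
have dM : \det M = l by rewrite det_adj2.
have WD k : \det (M *m X k) = l * \det (X k) by rewrite det_mulmx dM.
have WP j k : j != k -> polar (M *m X j) (M *m X k) = 0.
  by move=> jk; rewrite polar_mulmx X0 ?mulr0.
have WT k : 0 != k -> (M *m X k) 0 0 + (M *m X k) 1 1 = 0.
  by move=> k0; apply: (mulfI l0); rewrite -polar_scalar -MX WP ?mulr0.
have neq (j k : 'I_4) : (j : nat) != k -> j != k by apply: contraNneq => ->.
have [||||||||||||U UU] := @traceless_frame (M *m X 1) (M *m X (inord 2)) (M *m X (inord 3))
  (l * \det (X 1)) (l * \det (X (inord 2))) (l * \det (X (inord 3))).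
all: rewrite ?WD //.
- by apply: WT; apply: neq.
- by apply: WT; apply: neq; rewrite i2.
- by apply: WT; apply: neq; rewrite i3.
- by apply: WP; apply: neq; rewrite i2.
- by apply: WP; apply: neq; rewrite i3.
- by apply: WP; apply: neq; rewrite i2 i3.
- by rewrite mulr_ge0 ?Xd // ltW.
- by rewrite ler_pM2l // Xs // i2.
- by rewrite mulr_ge0 ?Xd // ltW.
rewrite /=; set S := _ *m U => core; exists U => //=; rewrite -/S.
have lC : l^* = l by rewrite geC0_conj // ltW.
have /core : 0 <= l ^+ 2 by rewrite exprn_ge0 // ltW.
have [d1 d3] : \det (X 1) <= l /\ \det (X (inord 3)) <= \det (X (inord 2)).
  by split; apply: Xs; rewrite // i2 i3.
have cond : l * \det (X 1) - l * \det (X (inord 2)) + l * \det (X (inord 3)) <= l ^+ 2.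
  rewrite -mulrBr -mulrDr expr2 ler_pM2l // -addrA [- _ + _]addrC.
  by rewrite -[leRHS]addr0 lerD // subr_le0.
move=> /(_ cond).
have -> : l ^+ 2 *: S + M *m X 1 *m S *m (M *m X 1)^t*
    + M *m X (inord 2) *m S *m (M *m X (inord 2))^t*
    + M *m X (inord 3) *m S *m (M *m X (inord 3))^t*
    = M *m (\sum_k X k *m S *m (X k)^t*) *m M^t*.
  rewrite sum4 !mulmxDr !mulmxDl !tradjM !mulmxA; congr (_ + _ + _ + _).
  rewrite MX -!mulmxA -tradjM MX mul_scalar_mx expr2 -scalerA; congr (_ *: _).
  by rewrite tr_scalar_mx map_scalar_mx /= lC mul_mx_scalar -!scalemxAr /S mulmxA.
rewrite !det_mulmx (det_map_mx conjC) det_tr dM /= lC -mulrN mulrAC.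
set E := _ - \det _ => ineq.
have l2 : 0 < l ^+ 2 by rewrite exprn_gt0.
rewrite -(ler_pM2l l2); apply: le_trans (le_trans _ ineq) _.
  by rewrite le_eqVlt; apply/orP; left; apply/eqP; rewrite /E; ring.
by rewrite expr2 mulrN.
Qed.


End Frame.

(** * Measurement of the second qubit, and mixing in pairs *)

Section MeasuredGram.
Import Num.Def.
Variable C : numClosedFieldType.
Local Open Scope sesquilinear_scope.

Lemma sqrtC2_half : (sqrtC 2)^-1 * (sqrtC 2)^-1 = 2^-1 :> C.
Proof. by rewrite -invfM -expr2 sqrtCK. Qed.

Lemma sqrtC2V_conj : ((sqrtC 2)^-1)^* = (sqrtC 2)^-1 :> C.
Proof. by rewrite geC0_conj // invr_ge0 sqrtC_ge0. Qed.

(** The columns are unit eigenvectors of [pauliY], for the eigenvalues 1 and -1. *)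
Definition eigenY : 'M[C]_2 := \matrix_(i, j)
  ((sqrtC 2)^-1 * (if i == 0 then 1 else if j == 0 then 'i else - 'i)).

Lemma eigenY_unitary : eigenY \is unitarymx.
Proof.
have ii : 'i * 'i = -1 :> C by rewrite -expr2 sqrCi.
have P u v : ((sqrtC 2)^-1 * u) * ((sqrtC 2)^-1 * v) = 2^-1 * (u * v) :> C.
  by rewrite mulrACA sqrtC2_half.
apply/unitarymxP; apply: mx2P; rewrite !mulmx2E !mxE /= !rmorphM ?rmorphN /=
  ?conjCi ?conjC1 sqrtC2V_conj !P.
- by field.
- by ring.
- by ring.
- by rewrite !mulrN !mulNr ii; field.
Qed.

Lemma eigenY_diag : eigenY *m diag2 1 (-1) *m eigenY^t* = pauliY C.
Proof.
have ii : 'i * 'i = -1 :> C by rewrite -expr2 sqrCi.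
have P u u' v v' : let s := (sqrtC 2)^-1 in
    (s * u * 1 + s * u' * 0) * (s * v) + (s * u * 0 + s * u' * -1) * (s * v')
    = 2^-1 * (u * v - u' * v') :> C.
  by rewrite /= -sqrtC2_half; ring.
apply: mx2P; rewrite !mulmx2E !mxE /= !rmorphM ?rmorphN /= ?conjCi ?conjC1
  sqrtC2V_conj P.
- by ring.
- by field.
- by field.
- by rewrite !mulrN !mulNr ii; field.
Qed.

(** The unnormalised state of the first qubit after outcome [s], when the second one is measured in
    the basis of conjugated columns of [K]. *)
Definition measured_gram (X : 'I_4 -> 'M[C]_2) (K : 'M[C]_2) (s : 'I_2) : 'M[C]_2 :=
  \matrix_(x, x') \sum_k (\sum_b X k x b * K b s) * (\sum_b X k x' b * K b s)^*.

Lemma measured_gramE X K s x x' : measured_gram X K s x x' =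
  \sum_k (X k *m K) x s * ((X k *m K) x' s)^*.
Proof. by rewrite mxE; apply: eq_bigr => k _; rewrite !mxE. Qed.

Lemma measured_gram_add X K : K \is unitarymx ->
  measured_gram X K 0 + measured_gram X K 1 = \sum_k X k *m (X k)^t*.
Proof.
move=> KU; apply/matrixP => x x'.
rewrite mxE !measured_gramE summxE -big_split; apply: eq_bigr => k _ /=.
have -> : X k *m (X k)^t* = (X k *m K) *m (X k *m K)^t*.
  by rewrite tradjM !mulmxA -(mulmxA (X k)) (unitarymxP KU) mulmx1.
by move: (X k *m K) => Y; rewrite mulmx2E !mxE.
Qed.

Lemma measured_gram_sub X K :
  measured_gram X K 0 - measured_gram X K 1 =
    \sum_k X k *m (K *m diag2 1 (-1) *m K^t*) *m (X k)^t*.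
Proof.
apply/matrixP => x x'.
rewrite [LHS]mxE [X in _ + X]mxE !measured_gramE summxE -sumrB; apply: eq_bigr => k _ /=.
have -> : X k *m (K *m diag2 1 (-1) *m K^t*) *m (X k)^t* =
   (X k *m K) *m diag2 1 (-1) *m (X k *m K)^t* by rewrite tradjM !mulmxA.
move: (X k *m K) => Y; rewrite !mulmx2E !mxE /=; ring.
Qed.

(** [K] consists of eigenvectors of the matrix [S] of [frame_det_le], so that the difference of the
    two outcomes is the sum of sandwiches of [S] bounded there. *)
Lemma measured_frame (X : 'I_4 -> 'M[C]_2) :
  (forall k l, k != l -> polar (X k) (X l) = 0) ->
  (forall k, 0 <= \det (X k)) ->
  (forall k l : 'I_4, (k <= l)%N -> \det (X l) <= \det (X k)) ->
  exists2 K : 'M[C]_2, K \is unitarymx &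
    (\det (X 0) - \det (X 1) + \det (X (inord 2)) - \det (X (inord 3))) ^+ 2
      <= - \det (measured_gram X K 0 - measured_gram X K 1).
Proof.
move=> X0 Xd Xs; have [U UU le] := frame_det_le X0 Xd Xs.
exists (U^t* *m eigenY).
  by rewrite mul_unitarymx ?eigenY_unitary // trmxC_unitary.
rewrite measured_gram_sub.
have -> : U^t* *m eigenY *m diag2 1 (-1) *m (U^t* *m eigenY)^t* = U^t* *m pauliY C *m U.
  by rewrite tradjM tradjK -eigenY_diag !mulmxA.
exact: le.
Qed.

(* The two vectors [(A +- 'i B) / sqrt 2] have the same mixture as [A] and [B],
   and orthogonality for the polar form of the determinant makes their
   determinants cancel instead of adding up. *)
Definition mixI (A B : 'M[C]_2) (b : bool) : 'M[C]_2 :=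
  (sqrtC 2)^-1 *: (A + (if b then 'i else - 'i) *: B).

Lemma det_mixI A B b : polar A B = 0 -> \det (mixI A B b) = (\det A - \det B) / 2.
Proof.
have ii (z : C) : z = (if b then 'i else - 'i) -> z * z = -1.
  by move=> ->; case: b; rewrite ?mulrNN -expr2 sqrCi.
move=> AB; rewrite /mixI; move: (ii _ erefl); set z := (if b then _ else _) => zz.
rewrite detZ expr2 sqrtC2_half.
have -> : \det (A + z *: B) = \det A + z * polar A B + z * z * \det B.
  by rewrite !det_mx22 /polar !mxE; ring.
by rewrite AB zz mulr0 addr0 mulN1r mulrC.
Qed.

Lemma mixI_mixture A B x y x' y' :
  mixI A B true x y * (mixI A B true x' y')^*
    + mixI A B false x y * (mixI A B false x' y')^*
  = A x y * (A x' y')^* + B x y * (B x' y')^*.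
Proof.
have ii : 'i * 'i = -1 :> C by rewrite -expr2 sqrCi.
have P u v : ((sqrtC 2)^-1 * u) * ((sqrtC 2)^-1 * v) = 2^-1 * (u * v) :> C.
  by rewrite mulrACA sqrtC2_half.
rewrite !mxE !rmorphM !rmorphD !rmorphM ?rmorphN /= conjCi sqrtC2V_conj !P opprK.
set a := A x y; set b := B x y; set a' := (A x' y')^*; set b' := (B x' y')^*.
have -> : 2^-1 * ((a + 'i * b) * (a' + - 'i * b')) + 2^-1 * ((a + - 'i * b) * (a' + 'i * b'))
  = a * a' - ('i * 'i) * (b * b') by field.
by rewrite ii mulN1r opprK.
Qed.

End MeasuredGram.

(** * Upper bounds on the concurrence from unnormalised mixtures *)

Section MixtureBound.
Variable R : realType.
Implicit Types T X Y I : finType.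

Definition weight T (phi : vec R T) : R := complex.Re (\sum_a conjc (phi a) * phi a).

(* The concurrence extended to unnormalised vectors, homogeneously of degree 2. *)
Definition uconc X Y (phi : vec R (X * Y)%type) : R :=
  Num.sqrt (2 * (weight phi ^+ 2 - purity (red_pure phi))).

Lemma uconc_ge0 X Y (phi : vec R (X * Y)%type) : 0 <= uconc phi.
Proof. exact: sqrtr_ge0. Qed.

Lemma Re_ge0_complexE (z : R[i]) : 0 <= z -> ((complex.Re z)%:C)%C = z.
Proof. by move=> z0; apply: RRe_real; apply: ger0_real. Qed.

Lemma conjc_mul_ge0 (z : R[i]) : 0 <= conjc z * z.
Proof. by rewrite mulrC; apply: mulcJ_ge0. Qed.

Lemma weightE T (phi : vec R T) :
  ((weight phi)%:C)%C = \sum_a conjc (phi a) * phi a.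
Proof.
by rewrite Re_ge0_complexE // sumr_ge0 // => a _; apply: conjc_mul_ge0.
Qed.

Lemma weight_ge0 T (phi : vec R T) : 0 <= weight phi.
Proof.
by rewrite -ler0c weightE sumr_ge0 // => a _; apply: conjc_mul_ge0.
Qed.

Lemma weight_eq0 T (phi : vec R T) : weight phi = 0 -> forall a, phi a = 0.
Proof.
move=> w0 a; have /eqP := weightE phi; rewrite w0 eq_sym psumr_eq0; last first.
  by move=> b _; apply: conjc_mul_ge0.
move=> /allP /(_ a); rewrite mem_index_enum => /(_ isT) /=.
by rewrite mulf_eq0 conjc_eq0 orbb => /eqP.
Qed.

Lemma Re_mulrC (c : R) (z : R[i]) : complex.Re ((c%:C)%C * z) = c * complex.Re z.
Proof. by case: z => a b /=; rewrite mul0r subr0. Qed.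

Lemma conjc_mul (z w : R[i]) : conjc (z * w) = conjc z * conjc w.
Proof. exact: rmorphM. Qed.

Lemma real_complexM (a b : R) : ((a * b)%:C)%C = (a%:C)%C * (b%:C)%C :> R[i].
Proof. exact: rmorphM. Qed.

Definition vscale T (c : R) (phi : vec R T) : vec R T := fun a => (c%:C)%C * phi a.

Lemma weight_scale T c (phi : vec R T) : weight (vscale c phi) = c ^+ 2 * weight phi.
Proof.
rewrite /weight -Re_mulrC; congr complex.Re; rewrite mulr_sumr.
apply: eq_bigr => a _; rewrite /vscale conjc_mul conjc_real !real_complexM; ring.
Qed.

Lemma purity_scale X Y c (phi : vec R (X * Y)%type) :
  purity (red_pure (vscale c phi)) = c ^+ 4 * purity (red_pure phi).
Proof.
have redE x x' : red_pure (vscale c phi) x x' = ((c ^+ 2)%:C)%C * red_pure phi x x'.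
  rewrite /red_pure mulr_sumr; apply: eq_bigr => y _.
  by rewrite /vscale conjc_mul conjc_real !real_complexM; ring.
rewrite /purity -Re_mulrC; congr complex.Re; rewrite mulr_sumr.
apply: eq_bigr => x _; rewrite mulr_sumr; apply: eq_bigr => x' _.
by rewrite !redE !real_complexM; ring.
Qed.

Lemma conc_pure_unit X Y (psi : vec R (X * Y)%type) :
  weight psi = 1 -> conc_pure psi = uconc psi.
Proof. by move=> w1; rewrite /conc_pure /uconc w1 expr1n. Qed.

Lemma uconc_scale X Y c (phi : vec R (X * Y)%type) :
  uconc (vscale c phi) = c ^+ 2 * uconc phi.
Proof.
rewrite /uconc weight_scale purity_scale.
have -> : 2 * ((c ^+ 2 * weight phi) ^+ 2 - c ^+ 4 * purity (red_pure phi))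
  = (c ^+ 2) ^+ 2 * (2 * (weight phi ^+ 2 - purity (red_pure phi))) by ring.
by rewrite sqrtrM ?sqr_ge0 // sqrtr_sqr ger0_norm // sqr_ge0.
Qed.

Lemma conc_has_lbound X Y (rho : op R (X * Y)%type) :
  has_lbound [set c : R | exists (N : nat) (p : 'I_N -> R)
    (psi : 'I_N -> vec R (X * Y)%type),
    is_ensemble p psi rho /\ c = \sum_(i < N) p i * conc_pure (psi i)]%classic.
Proof.
exists 0 => c [N [p [psi [[p0 _] ->]]]].
by rewrite sumr_ge0 // => i _; rewrite mulr_ge0 ?sqrtr_ge0 // ltW.
Qed.

(** An ensemble has positive probabilities and unit vectors, so null vectors are dropped and the
    others normalised, their weights becoming the probabilities; homogeneity of [uconc] absorbs the
    factors. *)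
Lemma mixture_ensemble X Y I (phi : I -> vec R (X * Y)%type) rho :
  \sum_a rho a a = 1 ->
  (forall a b, rho a b = \sum_i phi i a * conjc (phi i b)) ->
  exists (N : nat) (p : 'I_N -> R) (psi : 'I_N -> vec R (X * Y)%type),
    is_ensemble p psi rho /\
    \sum_(i < N) p i * conc_pure (psi i) <= \sum_i uconc (phi i).
Proof.
move=> tr1 rhoE.
pose J := [pred i | 0 < weight (phi i)].
pose h (j : 'I_#|J|) : I := enum_val j.
have hJ j : 0 < weight (phi (h j)) by have := enum_valP j.
have sumJ (V : nmodType) (F : I -> V) : (forall i, ~~ J i -> F i = 0) ->
    \sum_i F i = \sum_(j < #|J|) F (h j).
  move=> F0; rewrite (bigID J) /= [X in _ + X]big1 // addr0.
  by rewrite -big_enum_val.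
have notJ i : ~~ J i -> forall a, phi i a = 0.
  move=> nJ; apply: weight_eq0; apply/eqP; rewrite eq_le weight_ge0 andbT.
  by rewrite leNgt.
pose c j := (Num.sqrt (weight (phi (h j))))^-1.
have c2 j : c j ^+ 2 * weight (phi (h j)) = 1.
  by rewrite /c exprVn sqr_sqrtr ?weight_ge0 // mulVf // gt_eqF.
pose psi j := vscale (c j) (phi (h j)).
have wpsi j : weight (psi j) = 1 by rewrite weight_scale c2.
exists #|J|, (fun j => weight (phi (h j))), psi; split.
  split=> //; split; first last.
    split=> [j|a b]; first by rewrite /is_unit_vec -weightE wpsi.
    rewrite rhoE sumJ; last by move=> i /notJ ->; rewrite mul0r.
    apply: eq_bigr => j _; rewrite /psi /vscale conjc_mul conjc_real.
    transitivity (((c j ^+ 2 * weight (phi (h j)))%:C)%C *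
       (phi (h j) a * conjc (phi (h j) b))).
      by rewrite c2 mul1r.
    by rewrite !real_complexM; ring.
  rewrite -[LHS](sumJ _ (fun i => weight (phi i))); last first.
    by move=> i nJ; apply/eqP; rewrite eq_le weight_ge0 andbT leNgt.
  apply: (@complexI R); rewrite rmorph_sum /= -[RHS]tr1.
  transitivity (\sum_i \sum_a conjc (phi i a) * phi i a).
    by apply: eq_bigr => i _; rewrite -weightE.
  rewrite exchange_big /=; apply: eq_bigr => a _; rewrite rhoE.
  by apply: eq_bigr => i _; rewrite mulrC.
rewrite [leRHS]sumJ.
  apply: ler_sum => j _; rewrite conc_pure_unit // uconc_scale mulrA.
  by rewrite [_ * c j ^+ 2]mulrC c2 mul1r.
move=> i nJ; rewrite /uconc.
have w0 : weight (phi i) = 0 by apply/eqP; rewrite eq_le weight_ge0 andbT leNgt.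
have -> : purity (red_pure (phi i)) = 0.
  rewrite /purity big1 // => x _; rewrite big1 // => x' _.
  by rewrite /red_pure big1 ?mul0r // => y _; rewrite notJ // mul0r.
by rewrite w0 expr0n subr0 mulr0 sqrtr0.
Qed.

Lemma conc_le_mixture X Y I (phi : I -> vec R (X * Y)%type) rho :
  \sum_a rho a a = 1 ->
  (forall a b, rho a b = \sum_i phi i a * conjc (phi i b)) ->
  conc rho <= \sum_i uconc (phi i).
Proof.
move=> tr1 rhoE; have [N [p [psi [ens le]]]] := mixture_ensemble tr1 rhoE.
apply: le_trans le; apply: ge_inf; first exact: conc_has_lbound.
by exists N, p, psi.
Qed.

End MixtureBound.

(** * Concurrence of a qubit with another system through determinants *)

Section PureMonogamy.
Variable R : realType.
Local Notation C := R[i].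
Local Open Scope sesquilinear_scope.
Implicit Types Y T : finType.

Definition gram Y (phi : vec R ('I_2 * Y)%type) : 'M[C]_2 :=
  \matrix_(x, x') red_pure phi x x'.

Lemma big_I2 (V : nmodType) (F : 'I_2 -> V) : \sum_k F k = F 0 + F 1.
Proof.
rewrite !big_ord_recl big_ord0 addr0; congr (_ + F _); exact: val_inj.
Qed.

Lemma conjc_sum (J : finType) (F : J -> C) : conjc (\sum_j F j) = \sum_j conjc (F j).
Proof. exact: rmorph_sum. Qed.

(** Lagrange's identity: twice the determinant is a sum of squared moduli of 2x2 minors. *)
Lemma gram_det_ge0 Y (phi : vec R ('I_2 * Y)%type) : 0 <= \det (gram phi).
Proof.
have conjcB (z w : C) : conjc (z - w) = conjc z - conjc w by exact: rmorphB.
pose a y := phi (0, y); pose b y := phi (1, y).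
have det2 : \det (gram phi) *+ 2 =
    \sum_y \sum_z (a y * b z - a z * b y) * conjc (a y * b z - a z * b y).
  rewrite det_mx22 !mxE /red_pure !big_distrlr /= mulr2n.
  rewrite [X in _ + (X - _)]exchange_big [X in _ + (_ - X)]exchange_big /=.
  rewrite -!sumrB -big_split; apply: eq_bigr => y _ /=.
  rewrite -!sumrB -big_split; apply: eq_bigr => z _ /=.
  by rewrite conjcB !conjc_mul -/(a y) -/(b y) -/(a z) -/(b z); ring.
have : 0 <= \det (gram phi) *+ 2.
  by rewrite det2; do 2 (apply: sumr_ge0 => ? _); apply: mulcJ_ge0.
by rewrite pmulrn_lge0.
Qed.

(** For a 2x2 matrix [G], [(tr G)^2 - tr (G^2) = 2 det G]. *)
Lemma uconc_gram Y (phi : vec R ('I_2 * Y)%type) :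
  uconc phi = 2 * Num.sqrt (complex.Re (\det (gram phi))).
Proof.
have ReB (z w : C) : complex.Re (z - w) = complex.Re z - complex.Re w.
  by case: z w => [? ?] [? ?].
have wE : ((weight phi)%:C)%C = gram phi 0 0 + gram phi 1 1.
  rewrite weightE !mxE /red_pure.
  rewrite -(big_I2 (fun x => \sum_y phi (x, y) * conjc (phi (x, y)))) pair_bigA /=.
  by apply: eq_bigr => -[x y] _; rewrite mulrC.
rewrite /uconc.
have -> : 2 * (weight phi ^+ 2 - purity (red_pure phi))
    = 2 ^+ 2 * complex.Re (\det (gram phi)).
  have -> : weight phi ^+ 2 = complex.Re (((weight phi)%:C)%C * ((weight phi)%:C)%C).
    by rewrite -real_complexM.
  rewrite /purity -ReB expr2 -mulrA; congr (2 * _).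
  have -> : 2 * complex.Re (\det (gram phi)) = complex.Re (\det (gram phi) + \det (gram phi)).
    by case: (\det _) => u v /=; ring.
  congr complex.Re; rewrite wE !big_I2 det_mx22 !mxE; ring.
by rewrite sqrtrM ?sqr_ge0 // sqrtr_sqr ger0_norm.
Qed.

Definition mxvec2 (A : 'M[C]_2) : vec R ('I_2 * 'I_2)%type := fun u => A u.1 u.2.

Lemma uconc_mx (A : 'M[C]_2) : 0 <= \det A ->
  uconc (mxvec2 A) = 2 * complex.Re (\det A).
Proof.
move=> d0; rewrite uconc_gram.
have -> : gram (mxvec2 A) = A *m A^t*.
  apply/matrixP => x x'; rewrite !mxE /red_pure; apply: eq_bigr => y _.
  by rewrite !mxE.
rewrite det_mulmx (det_map_mx Num.conj) det_tr /= geC0_conj //.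
have dE := Re_ge0_complexE d0; rewrite -dE -real_complexM /= -expr2 sqrtr_sqr.
by rewrite ger0_norm // -ler0c dE.
Qed.

Definition pure_op T (phi : vec R T) : op R T := fun a b => phi a * conjc (phi b).

(** Tracing out [T] leaves a positive operator in dimension 4, so four terms suffice whatever the
    size of [T]. *)
Lemma red12_rank1 T (phi : vec R ('I_2 * ('I_2 * T))%type) :
  exists e : 'I_4 -> 'M[C]_2, forall u v,
    red12 (pure_op phi) u v = \sum_k e k u.1 u.2 * conjc (e k v.1 v.2).
Proof.
pose rho := red12 (pure_op phi).
pose n := #|{: 'I_2 * 'I_2}|.
pose A : 'M[C]_n := \matrix_(i, j) rho (enum_val i) (enum_val j).
have hA : A^t* = A.
  apply/matrixP => i j; rewrite !mxE -[LHS]/(conjc (rho _ _)) /rho /red12 conjc_sum.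
  by apply: eq_bigr => c _; rewrite /pure_op /= conjc_mul conjcK mulrC.
have pA (v : 'rV_n) : 0 <= (v *m A *m v^t*) 0 0.
  pose w c := \sum_i v 0 i * phi ((enum_val i).1, ((enum_val i).2, c)).
  have -> : (v *m A *m v^t*) 0 0 = \sum_c w c * conjc (w c).
    transitivity (\sum_j \sum_i \sum_c (v 0 i * phi ((enum_val i).1, ((enum_val i).2, c)))
        * conjc (v 0 j * phi ((enum_val j).1, ((enum_val j).2, c)))).
      rewrite mxE; apply: eq_bigr => j _; rewrite !mxE mulr_suml.
      apply: eq_bigr => i _; rewrite !mxE /rho /red12 mulr_sumr mulr_suml.
      by apply: eq_bigr => c _; rewrite /pure_op conjc_mul /=; ring.
    rewrite exchange_big /=.
    under eq_bigr do rewrite exchange_big /=.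
    rewrite exchange_big /=; apply: eq_bigr => c _.
    rewrite /w conjc_sum mulr_suml; apply: eq_bigr => i _.
    by rewrite mulr_sumr.
  by apply: sumr_ge0 => c _; apply: mulcJ_ge0.
have [e eE] := psd_sum_rank1 hA pA.
have rhoE u v : rho u v = \sum_k e k (enum_rank u) * conjc (e k (enum_rank v)).
  by have := eE (enum_rank u) (enum_rank v); rewrite mxE !enum_rankK.
have n4 : n = 4 by rewrite /n card_prod !card_ord.
exists (fun k => \matrix_(x, y) e (cast_ord (esym n4) k) (enum_rank (x, y))) => u v.
rewrite -/rho rhoE (reindex (cast_ord (esym n4))) /=; last first.
  by exists (cast_ord n4) => i _; rewrite ?cast_ordK ?cast_ordKV.
by apply: eq_bigr => k _; rewrite !mxE -!surjective_pairing.
Qed.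

End PureMonogamy.

(** * Monogamy for pure states *)

Section PureMonogamyBound.
Variable R : realType.
Local Notation C := R[i].
Implicit Types J T : finType.

(** The result of a measurement depends on the family only through its mixture; this identifies the
    Gram matrices computed from [phi] with those computed from [X]. *)
Lemma measured_mixtureE J (h : J -> 'I_2 -> 'I_2 -> C) (K : 'I_2 -> C) x x' :
  \sum_j (\sum_b h j x b * K b) * conjc (\sum_b h j x' b * K b) =
  \sum_b \sum_b' (\sum_j h j x b * conjc (h j x' b')) * (K b * conjc (K b')).
Proof.
transitivity (\sum_j \sum_b \sum_b'
    (h j x b * conjc (h j x' b')) * (K b * conjc (K b'))).
  apply: eq_bigr => j _; rewrite conjc_sum big_distrlr /=.
  apply: eq_bigr => b _; apply: eq_bigr => b' _; rewrite conjc_mul; ring.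
rewrite exchange_big /=; apply: eq_bigr => b _.
by rewrite exchange_big /=; apply: eq_bigr => b' _; rewrite mulr_suml.
Qed.

Lemma unitary_measured_sum (K : 'M[C]_2) (p q : 'I_2 -> C) : K \is unitarymx ->
  \sum_s (\sum_b p b * K b s) * conjc (\sum_b q b * K b s)
    = \sum_b p b * conjc (q b).
Proof.
move=> /unitarymxP /matrixP KK.
have K2 b b' : K b 0 * conjc (K b' 0) + K b 1 * conjc (K b' 1) = (b == b')%:R.
  by have := KK b b'; rewrite mulmx2E !mxE.
have conjcD (z w : C) : conjc (z + w) = conjc z + conjc w by exact: rmorphD.
rewrite !big_I2 !conjcD !conjc_mul.
transitivity (p 0 * conjc (q 0) * (K 0 0 * conjc (K 0 0) + K 0 1 * conjc (K 0 1))
  + p 0 * conjc (q 1) * (K 0 0 * conjc (K 1 0) + K 0 1 * conjc (K 1 1))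
  + p 1 * conjc (q 0) * (K 1 0 * conjc (K 0 0) + K 1 1 * conjc (K 0 1))
  + p 1 * conjc (q 1) * (K 1 0 * conjc (K 1 0) + K 1 1 * conjc (K 1 1))).
  by ring.
by rewrite !K2 /=; ring.
Qed.

Lemma big_I4 (V : nmodType) (F : 'I_4 -> V) :
  \sum_k F k = F 0 + F 1 + (F (inord 2) + F (inord 3)).
Proof.
rewrite !big_ord_recl big_ord0 addr0 !addrA.
by congr (_ + F _ + F _ + F _); apply: val_inj; rewrite //= inordK.
Qed.

Lemma big_bool2 (V : nmodType) (F : bool -> bool -> V) :
  \sum_(i : bool * bool) F i.1 i.2
    = F true true + F true false + (F false true + F false false).
Proof. by rewrite -(pair_bigA _ F) /= !big_bool. Qed.

Lemma det_parallelogram (A B : 'M[C]_2) :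
  - \det (A - B) = \det (A + B) - (\det A + \det B) *+ 2.
Proof. by rewrite !det_mx22 !mxE; ring. Qed.

Lemma sqr_sum_le (m s0 s1 sD : R) :
  m ^+ 2 <= sD ^+ 2 - (s0 ^+ 2 + s1 ^+ 2) *+ 2 ->
  (2 * m) ^+ 2 + (2 * s0 + 2 * s1) ^+ 2 <= (2 * sD) ^+ 2.
Proof. by move=> le; have := sqr_ge0 (s0 - s1); nra. Qed.

(** Explicit mixtures replace [conc] of the reduced states, so that those of all members of an
    ensemble can later be merged into one. *)
Lemma pure_monogamy T (phi : vec R ('I_2 * ('I_2 * T))%type) :
  exists (f : bool * bool -> vec R ('I_2 * 'I_2)%type)
         (g : 'I_2 -> vec R ('I_2 * T)%type),
  [/\ forall u v, red12 (pure_op phi) u v = \sum_i f i u * conjc (f i v),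
      forall u v, red13 (pure_op phi) u v = \sum_i g i u * conjc (g i v)
    & (\sum_i uconc (f i)) ^+ 2 + (\sum_i uconc (g i)) ^+ 2 <= uconc phi ^+ 2].
Proof.
have [e eE] := red12_rank1 phi.
have [X [XE X0 Xd Xs]] := polar_orthogonal_family_sorted e.
have rho12 u v : red12 (pure_op phi) u v = \sum_k X k u.1 u.2 * conjc (X k v.1 v.2).
  by rewrite eE -[LHS]XE.
have [K KU frame] := measured_frame X0 Xd Xs.
(* Pairing neighbours in decreasing order keeps the determinants nonnegative; each of the two
   matrices of a pair has concurrence equal to the difference of its determinants. *)
pose F b s := if b then mixI (X 0) (X 1) s else mixI (X (inord 2)) (X (inord 3)) s.
(* The vector left on A1A3 by outcome [s] of the measurement of A2. *)
pose g s : vec R ('I_2 * T)%type := fun w => \sum_b phi (w.1, (b, w.2)) * K b s.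
exists (fun i => mxvec2 (F i.1 i.2)), g.
have neq (j k : 'I_4) : (j : nat) != k -> j != k by apply: contraNneq => ->.
have p01 : polar (X 0) (X 1) = 0 by apply: X0.
have p23 : polar (X (inord 2)) (X (inord 3)) = 0.
  by apply: X0; apply: neq; rewrite !inordK.
split.
- move=> u v; rewrite rho12 big_I4.
  rewrite (big_bool2 (fun b s => mxvec2 (F b s) u * conjc (mxvec2 (F b s) v))).
  by congr (_ + _); rewrite -[LHS]mixI_mixture.
- by move=> u v; rewrite [RHS](unitary_measured_sum (fun b => phi (u.1, (b, u.2)))
    (fun b => phi (v.1, (b, v.2))) KU).
have gramg s : gram (g s) = measured_gram X K s.
  apply/matrixP => x x'; rewrite !mxE /red_pure /g /=.
  rewrite (measured_mixtureE (fun c x b => phi (x, (b, c))) (K^~ s)).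
  rewrite [RHS](measured_mixtureE X (K^~ s)).
  apply: eq_bigr => b _; apply: eq_bigr => b' _; congr (_ * _).
  exact: (rho12 (x, b) (x', b')).
have gramphi : gram phi = measured_gram X K 0 + measured_gram X K 1.
  rewrite measured_gram_add //; apply/matrixP => x x'; rewrite summxE !mxE /red_pure.
  transitivity (\sum_b red12 (pure_op phi) (x, b) (x', b)).
    by rewrite /red12 pair_bigA /=; apply: eq_bigr => -[b c].
  under eq_bigr do rewrite rho12.
  rewrite exchange_big /=; apply: eq_bigr => k _.
  by rewrite mxE; apply: eq_bigr => b _; rewrite !mxE.
have [l lE] : exists l : 'I_4 -> R, forall k, \det (X k) = ((l k)%:C)%C.
  by exists (fun k => complex.Re (\det (X k))) => k; rewrite Re_ge0_complexE.
have l0 k : 0 <= l k by rewrite -ler0c -lE.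
have ls (j k : 'I_4) : (j <= k)%N -> l k <= l j.
  by move=> jk; rewrite -lecR -!lE Xs.
have detF b s : \det (F b s) =
    (((if b then l 0 - l 1 else l (inord 2) - l (inord 3)) / 2)%:C)%C.
  have half : ((2^-1)%:C)%C = 2^-1 :> C by rewrite fmorphV rmorph_nat.
  have realB (x y : R) : ((x - y)%:C)%C = (x%:C)%C - (y%:C)%C :> C by exact: rmorphB.
  by rewrite /F; case: b; rewrite det_mixI // !lE real_complexM half realB.
clearbody F.
have uF b s : uconc (mxvec2 (F b s)) =
    if b then l 0 - l 1 else l (inord 2) - l (inord 3).
  have ge0 : 0 <= (if b then l 0 - l 1 else l (inord 2) - l (inord 3)).
    by case: b; rewrite subr_ge0 ls // !inordK.
  rewrite uconc_mx detF; first by rewrite /= mulrC divfK ?pnatr_eq0.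
  by rewrite ler0c divr_ge0.
have -> : \sum_i uconc (mxvec2 (F i.1 i.2))
    = 2 * (l 0 - l 1 + l (inord 2) - l (inord 3)).
  have -> := big_bool2 (fun b s => uconc (mxvec2 (F b s))).
  rewrite !uF /=.
  by move: (l 0) (l 1) (l (inord 2)) (l (inord 3)) => a b c d; ring.
rewrite big_I2 !uconc_gram !gramg gramphi.
set G0 := measured_gram X K 0 in frame gramphi *.
set G1 := measured_gram X K 1 in frame gramphi *.
have d0 : 0 <= \det G0 by rewrite /G0 -gramg gram_det_ge0.
have d1 : 0 <= \det G1 by rewrite /G1 -gramg gram_det_ge0.
have dD : 0 <= \det (G0 + G1) by rewrite -gramphi gram_det_ge0.
clear gramphi gramg; clearbody G0 G1.
(* The determinants are real, so the frame bound becomes [m^2 <= rD - 2 (r0 + r1)] over [R]. *)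
move: frame; rewrite det_parallelogram !lE.
rewrite -(Re_ge0_complexE d0) -(Re_ge0_complexE d1) -(Re_ge0_complexE dD) /=.
set r0 := complex.Re (\det G0); set r1 := complex.Re (\det G1).
set rD := complex.Re (\det (G0 + G1)).
rewrite -!rmorphB -!rmorphD -!rmorphB -rmorphXn -rmorphMn -!rmorphB lecR.
set m := _ - l (inord 3) => frame.
have r00 : 0 <= r0 by rewrite -ler0c Re_ge0_complexE.
have r10 : 0 <= r1 by rewrite -ler0c Re_ge0_complexE.
have rD0 : 0 <= rD by rewrite -ler0c Re_ge0_complexE.
clearbody r0 r1 rD.
by apply: sqr_sum_le; rewrite (sqr_sqrtr r00) (sqr_sqrtr r10) (sqr_sqrtr rD0).
Qed.

End PureMonogamyBound.

(** * Monogamy for mixed states *)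

Section MixedMonogamy.
Variable R : realType.
Local Notation C := R[i].
Local Open Scope sesquilinear_scope.

(** Ensures that a state has at least one ensemble, so that the infimum in [conc] is over a nonempty
    set. *)
Lemma state_rank1 (T : finType) (rho : op R T) : is_state rho ->
  exists e : 'I_#|T| -> vec R T, forall a b, rho a b = \sum_k e k a * conjc (e k b).
Proof.
move=> [herm [pos _]].
pose A : 'M[C]_#|T| := \matrix_(i, j) rho (enum_val i) (enum_val j).
have hA : A^t* = A by apply/matrixP => i j; rewrite !mxE -[LHS]/(conjc _) -herm.
have pA (v : 'rV_#|T|) : 0 <= (v *m A *m v^t*) 0 0.
  have -> : (v *m A *m v^t*) 0 0 = qform rho (fun a => conjc (v 0 (enum_rank a))).
    rewrite /qform exchange_big mxE (reindex enum_rank) /=; last first.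
      by apply: onW_bij; apply: enum_rank_bij.
    apply: eq_bigr => b _; rewrite !mxE mulr_suml (reindex enum_rank) /=; last first.
      by apply: onW_bij; apply: enum_rank_bij.
    by apply: eq_bigr => a _; rewrite !mxE !enum_rankK conjcK.
  have [im re] := pos (fun a => conjc (v 0 (enum_rank a))).
  by rewrite lecE /= im eqxx.
have [e eE] := psd_sum_rank1 hA pA.
exists (fun k a => e k (enum_rank a)) => a b.
by have := eE (enum_rank a) (enum_rank b); rewrite mxE !enum_rankK.
Qed.

Lemma conc_ge0 (X Y : finType) (rho : op R (X * Y)%type) : 0 <= conc rho.
Proof.
rewrite /conc; set E := (X in inf X).
have lb0 : lbound E 0.
  move=> c [N [p [psi [[p0 _] ->]]]].
  by rewrite sumr_ge0 // => i _; rewrite mulr_ge0 ?sqrtr_ge0 // ltW.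
(* The infimum of the empty set is 0, which covers operators without any ensemble. *)
have [->|/set0P E0] := eqVneq E set0; first by rewrite inf0.
exact: lb_le_inf.
Qed.

(** A form of convexity: the square roots of the probabilities are absorbed into the vectors,
    [uconc] being homogeneous of degree 2. *)
Lemma conc_le_ensemble_mixture (X Y J : finType) (N : nat) (p : 'I_N -> R)
    (h : 'I_N -> J -> vec R (X * Y)%type) (sigma : 'I_N -> op R (X * Y)%type) rho :
  (forall i, 0 < p i) -> \sum_a rho a a = 1 ->
  (forall a b, rho a b = \sum_i ((p i)%:C)%C * sigma i a b) ->
  (forall i a b, sigma i a b = \sum_j h i j a * conjc (h i j b)) ->
  conc rho <= \sum_i p i * \sum_j uconc (h i j).
Proof.
move=> p0 tr1 rhoE sE.
have -> : \sum_i p i * \sum_j uconc (h i j) =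
    \sum_(ij : 'I_N * J) uconc (vscale (Num.sqrt (p ij.1)) (h ij.1 ij.2)).
  rewrite -(pair_bigA _ (fun i j => uconc (vscale (Num.sqrt (p i)) (h i j)))) /=.
  apply: eq_bigr => i _; rewrite mulr_sumr; apply: eq_bigr => j _.
  by rewrite uconc_scale sqr_sqrtr // ltW.
apply: conc_le_mixture => // a b; rewrite rhoE.
rewrite -(pair_bigA _ (fun i j => vscale (Num.sqrt (p i)) (h i j) a *
   conjc (vscale (Num.sqrt (p i)) (h i j) b))) /=.
apply: eq_bigr => i _; rewrite sE mulr_sumr; apply: eq_bigr => j _.
rewrite /vscale conjc_mul conjc_real mulrACA -real_complexM -expr2.
by rewrite sqr_sqrtr // ltW.
Qed.

Lemma cauchy_le (x y a b c m : R) : 0 <= c -> 0 <= m ->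
  x ^+ 2 + y ^+ 2 <= c ^+ 2 -> a ^+ 2 + b ^+ 2 = m ^+ 2 -> x * a + y * b <= c * m.
Proof.
move=> c0 m0 xyc abm; rewrite leNgt; apply/negP => lt.
have := sqr_ge0 (x * b - y * a).
have cm0 : 0 <= c * m by rewrite mulr_ge0.
have lt2 : (c * m) ^+ 2 < (x * a + y * b) ^+ 2.
  by rewrite ltr_pXn2r ?nnegrE // ltW // (le_lt_trans cm0).
have le2 : (x ^+ 2 + y ^+ 2) * (a ^+ 2 + b ^+ 2) <= (c * m) ^+ 2.
  by rewrite exprMn -abm ler_wpM2r // addr_ge0 ?sqr_ge0.
have -> : (x * b - y * a) ^+ 2 =
  (x ^+ 2 + y ^+ 2) * (a ^+ 2 + b ^+ 2) - (x * a + y * b) ^+ 2 by ring.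
rewrite subr_ge0 => le1; have := le_lt_trans (le_trans le1 le2) lt2.
by rewrite ltxx.
Qed.

(** In any ensemble, [pure_monogamy] gives each member, of concurrence [c_i], mixtures of total
    concurrences [x_i] and [y_i], whose averages bound [a] and [b]. With [m^2 = a^2 + b^2],
    Cauchy-Schwarz yields [m^2 <= sum p_i (x_i a + y_i b) <= m sum p_i c_i], and [m] cancels unless
    it is 0. *)
Lemma concurrence_monogamy (T : finType) (rho : op R ('I_2 * ('I_2 * T))%type) :
  is_state rho ->
  conc (red12 rho) ^+ 2 + conc (red13 rho) ^+ 2 <= conc rho ^+ 2.
Proof.
move=> st; have [_ [_ tr1]] := st.
have tr12 : \sum_u red12 rho u u = 1.
  rewrite -[RHS]tr1 /red12 pair_bigA /=.
  pose h (u : 'I_2 * ('I_2 * T)) := ((u.1, u.2.1), u.2.2).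
  rewrite (reindex h) /=; last first.
    by exists (fun u => (u.1.1, (u.1.2, u.2))) => [[a [b c]]|[[a b] c]].
  by apply: eq_bigr => -[a [b c]].
have tr13 : \sum_u red13 rho u u = 1.
  rewrite -[RHS]tr1 /red13 pair_bigA /=.
  pose h (u : 'I_2 * ('I_2 * T)) := ((u.1, u.2.2), u.2.1).
  rewrite (reindex h) /=; last first.
    by exists (fun u => (u.1.1, (u.2, u.1.2))) => [[a [b c]]|[[a b] c]].
  by apply: eq_bigr => -[a [b c]].
set a := conc (red12 rho); set b := conc (red13 rho).
have a0 : 0 <= a by apply: conc_ge0.
have b0 : 0 <= b by apply: conc_ge0.
pose m := Num.sqrt (a ^+ 2 + b ^+ 2).
have m0 : 0 <= m by apply: sqrtr_ge0.
have m2 : a ^+ 2 + b ^+ 2 = m ^+ 2 by rewrite sqr_sqrtr // addr_ge0 ?sqr_ge0.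
rewrite m2 lerXn2r ?nnegrE ?conc_ge0 //.
have [e eE] := state_rank1 st.
have [N0 [p0 [psi0 [ens0 _]]]] := mixture_ensemble tr1 eE.
apply: lb_le_inf; first by exists (\sum_i p0 i * conc_pure (psi0 i)); exists N0, p0, psi0.
move=> _ [N [p [psi [[pp [p1 [unit rhoE]]] ->]]]].
have /choice [fg fgE] : forall i : 'I_N, exists fg :
    (bool * bool -> vec R ('I_2 * 'I_2)%type) * ('I_2 -> vec R ('I_2 * T)%type),
  [/\ forall u v, red12 (pure_op (psi i)) u v = \sum_j fg.1 j u * conjc (fg.1 j v),
      forall u v, red13 (pure_op (psi i)) u v = \sum_j fg.2 j u * conjc (fg.2 j v)
    & (\sum_j uconc (fg.1 j)) ^+ 2 + (\sum_j uconc (fg.2 j)) ^+ 2 <= uconc (psi i) ^+ 2].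
  by move=> i; have [f [g fg]] := pure_monogamy (psi i); exists (f, g).
have aE : a <= \sum_i p i * \sum_j uconc ((fg i).1 j).
  apply: (@conc_le_ensemble_mixture _ _ _ _ _ (fun i => (fg i).1)
    (fun i => red12 (pure_op (psi i)))) => //.
    move=> u v; rewrite /red12 /pure_op.
    under eq_bigr do rewrite rhoE.
    rewrite exchange_big /=; apply: eq_bigr => i _; rewrite mulr_sumr.
    by apply: eq_bigr => c _; rewrite mulrA.
  by move=> i u v; have [] := fgE i.
have bE : b <= \sum_i p i * \sum_j uconc ((fg i).2 j).
  apply: (@conc_le_ensemble_mixture _ _ _ _ _ (fun i => (fg i).2)
    (fun i => red13 (pure_op (psi i)))) => //.
    move=> u v; rewrite /red13 /pure_op.
    under eq_bigr do rewrite rhoE.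
    rewrite exchange_big /=; apply: eq_bigr => i _; rewrite mulr_sumr.
    by apply: eq_bigr => c _; rewrite mulrA.
  by move=> i u v; have [] := fgE i.
have le_m : m ^+ 2 <= (\sum_i p i * conc_pure (psi i)) * m.
  rewrite -m2 mulr_suml.
  apply: (@le_trans _ _ (\sum_i p i * (((\sum_j uconc ((fg i).1 j)) * a)
     + (\sum_j uconc ((fg i).2 j)) * b))).
    under eq_bigr do rewrite mulrDr !mulrA.
    by rewrite big_split /= -!mulr_suml !expr2 lerD // ler_wpM2r.
  apply: ler_sum => i _; rewrite -mulrA ler_wpM2l ?(ltW (pp i)) //.
  have w1 : weight (psi i) = 1 by apply: (@complexI R); rewrite weightE unit.
  rewrite conc_pure_unit //; apply: cauchy_le => //; first exact: uconc_ge0.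
  by have [] := fgE i.
have sum0 : 0 <= \sum_i p i * conc_pure (psi i).
  by rewrite sumr_ge0 // => i _; rewrite mulr_ge0 ?sqrtr_ge0 // ltW.
case: (eqVneq m 0) => [-> //|mn0].
have m_gt0 : 0 < m by rewrite lt_def mn0.
by rewrite -(ler_pM2r m_gt0) -expr2.
Qed.

End MixedMonogamy.

(* rho : state on H_{A1} (x) (H_{A2} (x) H_{A3}), dims 2, 2, 2^(n-2);
   conc rho is the concurrence for the cut A1 | A2A3. *)
Theorem theorem3 (R : realType) (n : nat)
    (rho : op R ('I_2 * ('I_2 * 'I_(2 ^ (n - 2))))%type) (k q beta s : R) :
  (3 <= n)%N -> is_state rho ->
  1 <= k -> 0 < q -> q <= 1 -> beta <= 0 -> 2 <= s ->
  (beta < 0 -> 0 < conc (red12 rho) /\ 0 < conc (red13 rho)) ->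
  (k * conc (red12 rho) `^ s <= conc (red13 rho) `^ s ->
     conc rho `^ beta <=
       q `^ (beta / s) * conc (red12 rho) `^ beta
       + ((1 + k) `^ (beta / s) - q `^ (beta / s)) / k `^ (beta / s)
         * conc (red13 rho) `^ beta) /\
  (k * conc (red13 rho) `^ s <= conc (red12 rho) `^ s ->
     conc rho `^ beta <=
       q `^ (beta / s) * conc (red13 rho) `^ beta
       + ((1 + k) `^ (beta / s) - q `^ (beta / s)) / k `^ (beta / s)
         * conc (red12 rho) `^ beta).
Proof.
move=> _ st k1 q0 q1 beta0 s2 pos.
have mono := concurrence_monogamy st.
(* The two parts are the same inequality with the reduced states exchanged. *)
split=> h; apply: concurrence_power_bound => //; rewrite ?conc_ge0 //.
- by move=> /pos [].
- by move=> /pos [].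
- by rewrite addrC.
Qed.
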